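(* Suppose the following two assumptions hold for the equation $\frac{du}{dt}=G(u)+\frac{dW}{dt}$ on $\mathbb{X}$ with the splitting $\mathbb{X}=\mathbb{X}_\ell\times\mathbb{X}_h$. (Assumption A) There exists a set $\mathcal{B}\subset C([0,\infty);\mathbb{X})$ with $\mathbb{P}\{\varphi^W_{[0,\infty)}u_0\in\mathcal{B}\}=1$ for all $u_0\in\mathbb{X}$ such that the following holds. If $u(t,W)$ and $\tilde u(t,W)$ are solutions of the equation and $\Omega_0\subset\Omega\times\Omega$ is such that every $(W,\tilde W)\in\Omega_0$ satisfies: $u(\cdot,W)\in\mathcal{B}$ and $\tilde u(\cdot,\tilde W)\in\mathcal{B}$; $\Pi_hW(t)-\Pi_hW(0)=\Pi_h\tilde W(t)-\Pi_h\tilde W(0)$ for all $t\ge0$; and $\Pi_\ell u(t,W)=\Pi_\ell\tilde u(t,\tilde W)$ for all $t\ge 0$; then $|\Pi_hu(t,W)-\Pi_h\tilde u(t,\tilde W)|_{\mathbb{X}}\to0$ as $t\to\infty$ for all $(W,\tilde W)\in\Omega_0$. (Assumption B) For all $t>0$ and all $(\ell_0,h_0)\in\mathbb{X}_\ell\times\mathbb{X}_h$, $Q^\eta_t(\ell_0,h_0,\cdot)$ is equivalent to Lebesgue measure on $\mathbb{X}_\ell$ for almost every $\eta$; and for all $\ell_0\in\mathbb{X}_\ell$ and $h_0,\tilde h_0\in\mathbb{X}_h$, the measure $Q^\eta_{[0,\infty)}(\ell_0,h_0,\cdot)$ is equivalent to $Q^\eta_{[0,\infty)}(\ell_0,\tilde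 h_0,\cdot)$ for almost every $\eta$. Then the equation $\frac{du}{dt}=G(u)+\frac{dW}{dt}$ has at most one $\mathbb{X}$-valued invariant probability measure (i.e. at most one invariant probability measure $\mu$ with $\mu(\mathbb{X})=1$).
   Context: $(\mathbb{X},|\cdot|_{\mathbb{X}},\langle\cdot,\cdot\rangle_{\mathbb{X}})$ is a complete separable Hilbert space with basis $\{e_k\}_{k\ge1}$. Consider the stochastic evolution equation $\frac{du}{dt}=G(u)+\frac{dW}{dt}$ on $\mathbb{X}$, where $G$ has domain $\mathcal{D}(G)\subset\mathbb{X}$ and $W(t)=\sum_k\sigma_ke_kb_k(t)$ with constants $\sigma_k$ and independent standard Brownian motions $b_k$; $\Omega$ is the (two-sided) path space of the driving Brownian motions and $\mathbb{P}$ the Wiener measure on it. The $\sigma_k$ are assumed to be such that the equation has a globally defined stochastic flow $\varphi^W_{s,t}$: $\varphi^W_{s,t}u_0=u(t,W)$ where $u(s)=u_0$; $\varphi^W_{[0,\infty)}u_0$ denotes the whole trajectory on $[0,\infty)$ started from $u_0$ at time $0$. Fix a positive integer $N_*$ and let $\mathbb{X}_\ell=\mathrm{span}\{e_k:k<N_*\}$, $\mathbb{X}_h=\mathrm{span}\{e_k:k\ge N_*\}$, with orthogonal projections $\Pi_\ell,\Pi_h$. Write $u=(\ell,h)=(\Pi_\ell u,\Pi_hu)$, $\eta=\Pi_hW$, $\xi=\Pi_\ell W$; $\mathbb{P}$ decomposes as the product of the laws of $\eta$ and $\xi$. ''Almost every $\eta$'' refers to the law of $\eta$. $\mathcal{F}^\eta_{[s,t]}$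 is the $\sigma$-algebra generated by the increments of $\eta$ on $[s,t]$. For Borel $A\subset\mathbb{X}_\ell$, $Q^\eta_t(\ell_0,h_0,A)=\mathbb{P}(\ell(t)\in A\mid\ell(0)=\ell_0,h(0)=h_0,\mathcal{F}^\eta_{[0,t]})$; for Borel $B\subset C([0,\infty);\mathbb{X}_\ell)$, $Q^\eta_{[0,\infty)}(\ell_0,h_0,B)=\mathbb{P}(\ell_{[0,\infty)}\in B\mid\ell(0)=\ell_0,h(0)=h_0,\mathcal{F}^\eta_{[0,\infty)})$, where $\ell_{[0,\infty)}$ is the trajectory of $\ell=\Pi_\ell u$. Two measures are equivalent if they are mutually absolutely continuous. A measure $\mu$ is invariant if $\mu(A)=\mathbb{E}\,\mu\{u_0:\varphi^W_{0,t}u_0\in A\}$ for all $t>0$ and Borel $A\subset\mathbb{X}$. *)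

(* Defs.v *)
(* The real numbers are an arbitrary R : realType. *)
From HB Require Import structures.
From mathcomp Require Import all_boot all_order all_algebra sesquilinear.
From mathcomp Require Import all_classical all_reals all_analysis.
From mathcomp Require Import measurable_realfun.
Import Order.TTheory GRing.Theory Num.Theory.
Import numFieldNormedType.Exports.

Set Implicit Arguments.
Unset Strict Implicit.
Unset Printing Implicit Defensive.

Local Open Scope classical_set_scope.
Local Open Scope ring_scope.

Notation borel T := (g_sigma_algebraType (@open T)).

(* Indices are shifted by one throughout: e k, sigma k and b k stand for
   e_{k+1}, sigma_{k+1} and b_{k+1} (k : nat), so that "index < Nstar" reads
   k < Nstar.-1 and "index >= Nstar" reads Nstar <= k.+1. *)

Section HilbertSpace.
Context (R : realType) (X : completeNormedModType R).
Variables (dot : {dot X for idfun}) (e : nat -> X) (Nstar : nat).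

(* Separability of X is part of this: e is countable and total. *)
Definition hilbert_basis :=
  [/\ forall x, `|x| ^+ 2 = dot x x,
      forall i j, dot (e i) (e j) = (i == j)%:R &
      forall x, (fun n => \sum_(k < n) dot x (e k) *: e k) @ \oo --> x].

Definition Xl : set X :=
  [set x | exists c : nat -> R, x = \sum_(k < Nstar.-1) c k *: e k].

Definition Xh : set X :=
  closure [set x | exists (m : nat) (c : nat -> R),
                     x = \sum_(Nstar.-1 <= k < m) c k *: e k].

Definition Pil (x : X) : X := \sum_(k < Nstar.-1) dot x (e k) *: e k.

Definition Pih (x : X) : X := x - Pil x.

(* Volume of {a : R^n | \sum_(k < n) a_k e_k \in A}, computed by Tonelli one
   coordinate at a time. *)
Fixpoint lebesgue_span (n : nat) (A : set X) : \bar R :=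
  if n is m.+1 then
    (\int[@lebesgue_measure R]_a lebesgue_span m [set y | A (y + a *: e m)%R])%E
  else @dirac _ (borel X) (0 : X) R A.

Definition lebesgue_Xl : set X -> \bar R := lebesgue_span Nstar.-1.

End HilbertSpace.

Definition equivalent_measures d (T : measurableType d) (R : realType)
    (mu nu : set T -> \bar R) :=
  forall A, measurable A -> (mu A = 0%E <-> nu A = 0%E).

(* C([0, oo); X) with the Borel sets of the topology of uniform convergence on
   compact sets (= compact-open topology). *)
Notation halfline R := (set_type [set t : R | 0 <= t]).

Definition Cpath (R : realType) (X : normedModType R) :=
  continuousType (halfline R) X.

HB.instance Definition _ (R : realType) (X : normedModType R) :=
  Choice.on (Cpath X).
HB.instance Definition _ (R : realType) (X : normedModType R) :=
  isPointed.Build (Cpath X) (cst 0 : continuousType (halfline R) X).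

Definition Cpath_open (R : realType) (X : normedModType R) :
    set (set (Cpath X)) :=
  @open (initial_topology
           (id : continuousType (halfline R) X ->
                 {compact-open, halfline R -> X})).

Notation borel_Cpath X := (g_sigma_algebraType (@Cpath_open _ X)).

(* Restriction to [0, oo) of a path that is continuous there; the default
   value is used only for discontinuous paths. *)
Definition path_of (R : realType) (X : normedModType R) (f : R -> X) :
    Cpath X :=
  xget (cst 0 : continuousType (halfline R) X)
       [set g : continuousType (halfline R) X |
          forall t : halfline R, g t = f (\val t)].

Record wpath (R : realType) := WPath {
  wpath_val :> nat -> R -> R ;
  wpath_continuous : forall k, continuous (wpath_val k) ;
  wpath_at0 : forall k, wpath_val k 0 = 0 }.

HB.instance Definition _ (R : realType) := gen_eqMixin (wpath R).
HB.instance Definition _ (R : realType) := gen_choiceMixin (wpath R).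
HB.instance Definition _ (R : realType) := isPointed.Build (wpath R)
  (@WPath R (fun _ => cst 0) (fun=> @cst_continuous R R 0) (fun=> erefl)).

Definition wpath_cylinder (R : realType) : set (set (wpath R)) :=
  [set E | exists (k : nat) (t : R) (A : set R),
     measurable A /\ E = [set w : wpath R | A (w k t)]].

Notation Omega R := (g_sigma_algebraType (@wpath_cylinder R)).

Section Noise.
Context (R : realType).

(* Under P the b_k are independent two-sided standard Brownian motions:
   increments over disjoint intervals, for all indices k jointly, are
   independent and N(0, length); b_k(0) = 0 is built into wpath. The second
   parameter of normal_prob is the standard deviation. *)
Definition is_wiener (P : probability (Omega R) R) :=
  forall (n m : nat) (t : nat -> R) (A : nat -> nat -> set R),
    (forall j, (j < m)%N -> t j < t j.+1) ->
    (forall k j, measurable (A k j)) ->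
    P [set w : wpath R | forall k j, (k < n)%N -> (j < m)%N ->
                           A k j (w k (t j.+1) - w k (t j))] =
    (\prod_(k < n) \prod_(j < m)
       normal_prob 0 (Num.sqrt (t j.+1 - t j)) (A k j))%E.

Variables (sigma : nat -> R) (Nstar : nat).

(* W is handled through its coordinates sigma_k b_k, so the series
   \sum_k sigma_k b_k e_k is not required to converge in X.  The increments of
   eta = Pi_h W over the time set I generate F^eta_I. *)
Definition eta_events (I : set R) : set (set (wpath R)) :=
  [set E | exists (k : nat) (r r' : R) (A : set R),
     [/\ (Nstar <= k.+1)%N, I r, I r', measurable A &
         E = [set w : wpath R | A (sigma k * w k r' - sigma k * w k r)]]].

(* K w is a regular version of the conditional law of Y given <<s F >>. *)
Definition regular_conditional_law d (T : measurableType d)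
    (P : probability (Omega R) R) (F : set (set (wpath R)))
    (Y : wpath R -> T) (K : wpath R -> probability T R) :=
  forall B : set T, measurable B ->
    measurable_fun [set: g_sigma_algebraType F] (fun w => K w B : \bar R) /\
    forall E : set (Omega R), <<s F >> E ->
      P (E `&` [set w | B (Y w)]) = (\int[P]_(w in E) K w B)%E.

End Noise.

Section Equation.
Context (R : realType) (X : completeNormedModType R).
Variables (dot : {dot X for idfun}) (e : nat -> X) (Nstar : nat).
Variables (DG : set X) (G : X -> X) (sigma : nat -> R).
Variable P : probability (Omega R) R.

(* u solves du/dt = G(u) + dW/dt on [s, oo) along the noise path w: u takes
   values in D(G) at almost every time, and the time-integrated equation holds
   in each coordinate.  g is a Borel version of <G(u), e_k>, since G is
   meaningless outside DG. *)
Definition solves (w : wpath R) (s : R) (u : R -> X) :=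
  [/\ {within `[s, +oo[, continuous u},
      (\forall t \ae (@lebesgue_measure R), s <= t -> DG (u t)) &
      forall k, exists g : R -> R,
        (\forall t \ae (@lebesgue_measure R),
           s <= t -> g t = dot (G (u t)) (e k)) /\
        (forall t, s <= t ->
           (@lebesgue_measure R).-integrable `[s, t] (EFin \o g) /\
           dot (u t) (e k) =
             dot (u s) (e k) + \int[@lebesgue_measure R]_(r in `[s, t]) g r
             + (sigma k * w k t - sigma k * w k s))].

(* phi s t w u0 is the flow map at w applied to u0.  The exceptional null set
   is independent of s and u0; on it phi only has to be continuous in t. *)
Definition stochastic_flow (phi : R -> R -> wpath R -> X -> X) :=
  [/\ forall s t, s <= t ->
        measurable_fun setT
          (fun z : (Omega R * borel X)%type => phi s t z.1 z.2 : borel X),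
      forall s w u0, {within `[s, +oo[, continuous (fun t => phi s t w u0)} &
      \forall w \ae P, forall s u0,
        [/\ phi s s w u0 = u0,
            solves w s (fun t => phi s t w u0) &
            forall v, solves w s v -> v s = u0 ->
              forall t, s <= t -> v t = phi s t w u0]].

Variable phi : R -> R -> wpath R -> X -> X.

Definition assumptionA :=
  exists Bset : set (Cpath X),
    (forall u0, \forall w \ae P, Bset (path_of (fun t => phi 0 t w u0))) /\
    forall (u v : wpath R -> R -> X) (Omega0 : set (wpath R * wpath R)),
      (forall w w', Omega0 (w, w') ->
         [/\ solves w 0 (u w) /\ solves w' 0 (v w'),
             Bset (path_of (u w)) /\ Bset (path_of (v w')),
             (forall t, 0 <= t -> forall k, (Nstar <= k.+1)%N ->
                sigma k * w k t - sigma k * w k 0 =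
                sigma k * w' k t - sigma k * w' k 0) &
             (forall t, 0 <= t ->
                Pil dot e Nstar (u w t) = Pil dot e Nstar (v w' t))]) ->
      forall w w', Omega0 (w, w') ->
        `|Pih dot e Nstar (u w t) - Pih dot e Nstar (v w' t)|
          @[t --> +oo] --> (0 : R).

(* Q^eta_t and Q^eta_[0, oo) are given by arbitrary regular versions, carried
   as measures on X, resp. C([0, oo); X), concentrated on Xl, resp. on
   Xl-valued paths. *)
Definition is_Qt (Qt : R -> X -> X -> wpath R -> probability (borel X) R) :=
  forall t l0 h0, 0 < t -> Xl e Nstar l0 -> Xh e Nstar h0 ->
    regular_conditional_law P (eta_events sigma Nstar `[0, t])
      (fun w => Pil dot e Nstar (phi 0 t w (l0 + h0)) : borel X)
      (Qt t l0 h0).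

Definition is_Qinf (Qinf : X -> X -> wpath R -> probability (borel_Cpath X) R)
    :=
  forall l0 h0, Xl e Nstar l0 -> Xh e Nstar h0 ->
    regular_conditional_law P (eta_events sigma Nstar `[0, +oo[)
      (fun w => path_of (fun t => Pil dot e Nstar (phi 0 t w (l0 + h0)))
                : borel_Cpath X)
      (Qinf l0 h0).

(* Q^eta depends on w only through eta, so "for almost every eta" is "for
   P-almost every w". *)
Definition assumptionB
    (Qt : R -> X -> X -> wpath R -> probability (borel X) R)
    (Qinf : X -> X -> wpath R -> probability (borel_Cpath X) R) :=
  (forall t l0 h0, 0 < t -> Xl e Nstar l0 -> Xh e Nstar h0 ->
     \forall w \ae P,
       equivalent_measures (T := borel X) (Qt t l0 h0 w)
         (lebesgue_Xl e Nstar)) /\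
  (forall l0 h0 h0', Xl e Nstar l0 -> Xh e Nstar h0 -> Xh e Nstar h0' ->
     \forall w \ae P, equivalent_measures (Qinf l0 h0 w) (Qinf l0 h0' w)).

Definition invariant_measure (mu : probability (borel X) R) :=
  forall t, 0 < t -> forall A : set (borel X), measurable A ->
    mu A = (\int[P]_w mu [set u0 | A (phi 0 t w u0)])%E.

End Equation.

(* Main.v *)
(* If mu and nu are different invariant measures, the two parts mu1, mu2 of the
   Jordan decomposition of mu - nu are again invariant, nonzero and carried by
   disjoint sets, so trajectories started from mu1 and from mu2 are with large
   probability, at each single time, in closed sets F1 and F2 at positive
   distance.  Midpoint-convex combinations of the functions 1_F1 - 1_F2
   evaluated along the flow that nearly minimise the L2 norm form a fast Cauchy
   sequence; it follows that, for almost every pair of trajectories of the two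
   kinds, these two events occur at infinitely many common times.

   By the first half of Assumption B the low-mode marginals of mu1 and mu2 are
   both equivalent to Lebesgue measure, so there are initial points u, v with
   the same low modes that are typical for mu1 and mu2.  By the second half the
   joint laws of (noise increments of eta, low-mode path) started from u and
   from v are equivalent, so there are noise paths w, w', each outside a
   prescribed null set, with the same eta and the same low-mode path.
   Assumption A makes the two trajectories converge to each other, against the
   positive distance between F1 and F2 at infinitely many times.

   Both selections replace the disintegration of measures by one principle: if
   random variables Z1, Z2 on tight spaces have laws with the same null sets,
   any two sets of full measure contain points with Z1 = Z2, since compact sets
   on which Z1, Z2 are continuous have compact images. *)

Require Import Defs.
From HB Require Import structures.
From mathcomp Require Import all_boot all_order all_algebra sesquilinear.
From mathcomp Require Import all_classical all_reals all_analysis.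
From mathcomp Require Import measurable_realfun lra ring.
Import Order.TTheory GRing.Theory Num.Theory.
Import numFieldNormedType.Exports.

Set Implicit Arguments.
Unset Strict Implicit.
Unset Printing Implicit Defensive.

Local Open Scope classical_set_scope.
Local Open Scope ring_scope.

(** * Inner approximation by closed classes *)

Lemma measurable_preimage d1 d2 (T : measurableType d1) (U : measurableType d2)
    (f : T -> U) (B : set U) :
  measurable_fun setT f -> measurable B -> measurable (f @^-1` B).
Proof. by move=> mf mB; rewrite -[X in measurable X]setTI; exact: mf. Qed.

Section FiniteMeasure.
Context d (T : measurableType d) (R : realType).
Variable mu : {finite_measure set T -> \bar R}.

Lemma measure_bigcup_small (A : nat -> set T) (x : R) : 0 <= x ->
  (forall i, measurable (A i)) ->
  (forall i, (mu (A i) <= (x / (2 ^ i.+1)%:R)%:E)%E) ->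
  (mu (\bigcup_i A i) <= x%:E)%E.
Proof.
move=> x0 mA Ax.
have mUA : measurable (\bigcup_i A i) by exact: bigcup_measurable.
have := @measure_sigma_subadditive _ _ _ mu _ A mA mUA (@subset_refl _ _).
move=> /le_trans; apply.
apply: le_trans (epsilon_trick0 xpredT x0).
by apply: lee_nneseries => // i _; exact: Ax.
Qed.

(** Continuity from above; the slack between x and y lets a bound on the limit pass to a single
    term. *)
Lemma measure_nonincreasing_small (F : nat -> set T) (x y : R) : x < y ->
  (forall i, measurable (F i)) -> nonincreasing_seq F ->
  (mu (\bigcap_i F i) <= x%:E)%E -> exists n, (mu (F n) <= y%:E)%E.
Proof.
move=> xy mF niF Fx.
have mI : measurable (\bigcap_i F i) by exact: bigcap_measurable.
have F0 : (mu (F 0%N) < +oo)%E by rewrite ltey_eq fin_num_measure.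
have := nonincreasing_cvg_mu F0 mF mI niF.
move=> /(_ [set z : \bar R | (z < y%:E)%E]) [].
  apply: (@open_nbhs_nbhs _ (mu (\bigcap_i F i)) [set z | (z < y%:E)%E]).
  by split => //=; [exact: open_ereal_lt_ereal | exact: le_lt_trans Fx _].
by move=> n _ /(_ n (leqnn n)) /= /ltW ?; exists n.
Qed.

Lemma le_finite_measure (A B : set T) : measurable A -> measurable B ->
  A `<=` B -> (mu A <= mu B)%E.
Proof. by move=> mA mB AB; rewrite le_measure// inE. Qed.

Variable C : set (set T).
Hypotheses (mC : C `<=` measurable) (C0 : C set0) (CT : C setT)
  (CU : forall A B, C A -> C B -> C (A `|` B))
  (CI : forall A : nat -> set T, (forall i, C (A i)) -> C (\bigcap_i A i)).

Definition inner_approx (A : set T) :=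
  forall x : R, 0 < x ->
    exists F, [/\ C F, F `<=` A & (mu (A `\` F) <= x%:E)%E].

(** [C] is stable under finite unions only, so half of x pays for approximating each [A i] and the
    other half for cutting the union of the approximants after finitely many terms. *)
Lemma inner_approx_bigcup (A : nat -> set T) : (forall i, measurable (A i)) ->
  (forall i, inner_approx (A i)) -> inner_approx (\bigcup_i A i).
Proof.
move=> mA hA x x0.
have x2 : 0 < x / 2 by rewrite divr_gt0.
have /choice[F hF] i : exists F, [/\ C F, F `<=` A i &
    (mu (A i `\` F) <= (x / 2 / (2 ^ i.+1)%:R)%:E)%E].
  by apply: hA; rewrite divr_gt0// ltr0n expn_gt0.
have mF i : measurable (F i) by apply: mC; have [] := hF i.
have CUn n : C (\big[setU/set0]_(i < n) F i).
  by elim/big_ind : _ => // i _; have [] := hF i.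
have mUA : measurable (\bigcup_i A i) by exact: bigcup_measurable.
have mG n : measurable ((\bigcup_i A i) `\` \big[setU/set0]_(i < n) F i).
  by apply: measurableD => //; exact: mC.
have [||||n hn] := @measure_nonincreasing_small
  (fun n => (\bigcup_i A i) `\` \big[setU/set0]_(i < n) F i) (x / 2) x.
- by rewrite ltr_pdivrMr// mulr_natr mulr2n ltrDl.
- by [].
- move=> m n mn; apply/subsetPset; apply: setDS.
  exact: subset_bigsetU.
- apply: (@le_trans _ _ (mu (\bigcup_i (A i `\` F i)))).
    apply: le_finite_measure.
    + exact: bigcap_measurable.
    + by apply: bigcup_measurable => i _; exact: measurableD.
    + move=> t h; have /= [[i _ Ait] _] := h 0%N I.
      exists i => //; split=> // Fit; have /= [_ +] := h i.+1 I; apply.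
      by rewrite -bigcup_mkord; exists i => //=.
  apply: measure_bigcup_small; first exact: ltW.
  - by move=> i; exact: measurableD.
  - by move=> i; have [] := hF i.
- exists (\big[setU/set0]_(i < n) F i); split => //.
  rewrite -bigcup_mkord => t [i _ Fit].
  by exists i => //; have [_ + _] := hF i; exact.
Qed.

(** [C] is stable under countable intersections, so nothing is truncated: the defect of the
    intersection lies in the union of the defects. *)
Lemma inner_approx_bigcap (A : nat -> set T) : (forall i, measurable (A i)) ->
  (forall i, inner_approx (A i)) -> inner_approx (\bigcap_i A i).
Proof.
move=> mA hA x x0.
have /choice[F hF] i : exists F, [/\ C F, F `<=` A i &
    (mu (A i `\` F) <= (x / (2 ^ i.+1)%:R)%:E)%E].
  by apply: hA; rewrite divr_gt0// ltr0n expn_gt0.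
have mF i : measurable (F i) by apply: mC; have [] := hF i.
exists (\bigcap_i F i); split.
- by apply: CI => i; have [] := hF i.
- by move=> t h i _; have [_ + _] := hF i; apply; exact: h.
- apply: (@le_trans _ _ (mu (\bigcup_i (A i `\` F i)))).
    apply: le_finite_measure.
    + by apply: measurableD; exact: bigcap_measurable.
    + by apply: bigcup_measurable => i _; exact: measurableD.
    + move=> t [h /existsNP[i /not_implyP[_ nFi]]].
      by exists i => //; split => //; exact: h.
  apply: measure_bigcup_small; first exact: ltW.
  - by move=> i; exact: measurableD.
  - by move=> i; have [] := hF i.
Qed.

Lemma inner_approx_refl (A : set T) : C A -> inner_approx A.
Proof.
by move=> CA x x0; exists A; split => //; rewrite setDv measure0 lee_fin ltW.
Qed.

(** The sets that are approximable together with their complements form a sigma-algebra: complements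
    by symmetry, countable unions by the two preceding lemmas. *)
Lemma inner_approx_sigma (G : set (set T)) : G `<=` measurable ->
  (forall A, G A -> inner_approx A /\ inner_approx (~` A)) ->
  forall A, <<s G >> A -> inner_approx A.
Proof.
move=> mG hG A sA.
have : [set A | [/\ measurable A, inner_approx A & inner_approx (~` A)]] A.
  apply: smallest_sub sA.
    split => /=.
    - split; first exact: measurable0.
        exact: inner_approx_refl.
      by rewrite setC0; exact: inner_approx_refl.
    - move=> B [mB B1 B2]; rewrite setTD setCK; split => //.
      exact: measurableC.
    - move=> B hB; split.
      + by apply: bigcup_measurable => i _; have [] := hB i.
      + by apply: inner_approx_bigcup => i; have [] := hB i.
      + rewrite setC_bigcup; apply: inner_approx_bigcap => i.
          by apply: measurableC; have [] := hB i.
        by have [] := hB i.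
  by move=> B GB; have [] := hG _ GB; split => //; exact: mG.
by case.
Qed.

End FiniteMeasure.

(** * Common times for two families of large events *)

(** The infima of q over the decreasing sets [K N] increase to a finite limit. At index [M j] the
    infimum is within eta j / 2 of that limit, and [y j] minimises q on [K (M j)] up to eta j / 2;
    hence [y j.+1] also nearly minimises over the larger set [K (M j)]. *)
Lemma almost_minimizers (R : realType) (V : Type) (K : nat -> set V)
    (q : V -> R) (B : R) (eta : nat -> R) :
  (forall N, K N !=set0) -> (forall N N', (N <= N')%N -> K N' `<=` K N) ->
  (forall N y, K N y -> 0 <= q y <= B) -> (forall j, 0 < eta j) ->
  exists (M : nat -> nat) (y : nat -> V), forall j,
    [/\ (j <= M j <= M j.+1)%N, K (M j) (y j) &
        forall z, K (M j) z ->
          q (y j) <= q z + eta j /\ q (y j.+1) <= q z + eta j + eta j.+1].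
Proof.
move=> K0 Kdec qB eta0.
have qlb N : has_lbound [set q y | y in K N].
  by exists 0 => _ [y /qB /andP[+ _] <-].
have qne N : [set q y | y in K N] !=set0.
  by have [y Ky] := K0 N; exists (q y); exists y.
pose d N := inf [set q y | y in K N].
have dle N z : K N z -> d N <= q z.
  by move=> Kz; apply: ge_inf => //; exists z.
have dB N : d N <= B.
  by have [y Ky] := K0 N; rewrite (le_trans (dle _ _ Ky))//; have /andP[] := qB _ _ Ky.
have dinc N N' : (N <= N')%N -> d N <= d N'.
  move=> NN; apply: lb_le_inf => // _ [z Kz <-].
  exact/dle/(Kdec _ _ NN).
have dsup : has_sup (range d).
  by split; [exists (d 0%N); exists 0%N | exists B => _ [n _ <-]].
have dD N : d N <= sup (range d) by apply: ub_le_sup; [case: dsup|exists N].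
have /choice[N hN] j : exists N, sup (range d) - eta j / 2 < d N.
  have [||_ [N _ <-] ?] := @sup_adherent _ (range d) (eta j / 2).
  - by rewrite divr_gt0.
  - by [].
  - by exists N.
(* Summing makes M nondecreasing and keeps [M j] at least j and at least [N j]. *)
pose M j := (j + \sum_(i < j.+1) N i)%N.
have NM j : (N j <= M j)%N.
  by rewrite /M big_ord_recr /= addnA leq_addl.
have /choice[y hy] j : exists y, K (M j) y /\ q y < d (M j) + eta j / 2.
  have [||_ [y Ky <-] ?] := @inf_adherent _ [set q y | y in K (M j)] (eta j / 2).
  - by rewrite divr_gt0.
  - by split.
  - by exists y.
exists M, y => j; have [Ky qy] := hy j; split => //.
  by rewrite leq_addr /M (big_ord_recr j.+1)/= leq_add// leq_addr.
move=> z Kz; have := dle _ _ Kz.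
have [_] := hy j.+1; have := dD (M j.+1).
have := hN j; have := dinc _ _ (NM j).
have := eta0 j; have := eta0 j.+1.
by move=> *; split; lra.
Qed.

Lemma measurable_set_ler d (T : measurableType d) (R : realType) (f g : T -> R) :
  measurable_fun setT f -> measurable_fun setT g ->
  measurable [set s | f s <= g s].
Proof.
move=> mf mg; have := measurable_fun_ler mf mg measurableT.
by move=> /(_ [set true] Logic.I); rewrite setTI preimage_true.
Qed.

Lemma markov_le_integral d (T : measurableType d) (R : realType)
    (mu : {measure set T -> \bar R}) (f : T -> R) (a : R) : 0 < a ->
  measurable_fun setT f -> (forall s, 0 <= f s) ->
  (mu [set s | (a <= f s)%R] * a%:E <= \int[mu]_s (f s)%:E)%E.
Proof.
move=> a0 mf f0.
have mA : measurable [set s | a <= f s].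
  exact: (@measurable_set_ler _ _ _ (cst a)).
rewrite muleC -(setIT [set s | a <= f s]).
rewrite -(@integral_indic _ _ _ mu _ measurableT _ mA).
rewrite -ge0_integralZl_EFin ?(ltW a0)//; last exact/measurable_EFinP.
apply: ge0_le_integral => //.
- by move=> s _; rewrite -EFinM lee_fin mulr_ge0// ltW.
- by apply: measurable_funeM; exact/measurable_EFinP.
- exact/measurable_EFinP.
- move=> s _; rewrite -EFinM lee_fin indicE; have [|_] := boolP (s \in _).
    by rewrite inE /= mulr1.
  by rewrite mulr0.
Qed.

Section CommonTimes.
Context d (T : measurableType d) (R : realType).

(** Midpoints take the place of general convex combinations: the parallelogram identity compares two
    functions with their midpoint only. *)
Inductive midconvex (g : nat -> T -> R) (N : nat) : set (T -> R) :=
| midconvex_base n : (N <= n)%N -> midconvex g N (g n)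
| midconvex_mid y z : midconvex g N y -> midconvex g N z ->
    midconvex g N (fun s => (y s + z s) / 2).

Variable g : nat -> T -> R.

Lemma midconvex_mono N N' : (N <= N')%N -> midconvex g N' `<=` midconvex g N.
Proof.
move=> NN y; elim=> [n N'n|{}y z _ hy _ hz].
  by apply: midconvex_base; exact: leq_trans N'n.
exact: midconvex_mid.
Qed.

(** An average of differences is at most the largest of them, so a gap for a combination gives a gap
    at a single index. *)
Lemma midconvex_diff N y s1 s2 : midconvex g N y ->
  exists2 n, (N <= n)%N & y s1 - y s2 <= g n s1 - g n s2.
Proof.
elim=> [n Nn|{}y z _ [n Nn hn] _ [m Nm hm]]; first by exists n.
have [h|h] := leP (g n s1 - g n s2) (g m s1 - g m s2).
  by exists m => //; lra.
by exists n => //; lra.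
Qed.

Hypotheses (mg : forall n, measurable_fun setT (g n))
  (g1 : forall n s, `|g n s| <= 1).

Lemma midconvex_measurable N y : midconvex g N y -> measurable_fun setT y.
Proof.
elim=> [n _|{}y z _ my _ mz]; first exact: mg.
by apply: measurable_funM => //; exact: measurable_funD.
Qed.

Lemma midconvex_le1 N y s : midconvex g N y -> `|y s| <= 1.
Proof.
elim=> [n _|{}y z _ my _ mz]; first exact: g1.
by move: my mz; rewrite !ler_norml => /andP[? ?] /andP[? ?]; apply/andP; split; lra.
Qed.

Variable mu : {finite_measure set T -> \bar R}.

Let q (y : T -> R) : \bar R := (\int[mu]_s ((y s) ^+ 2)%:E)%E.

Let q_ge0 y : (0 <= q y)%E.
Proof. by apply: integral_ge0 => s _; rewrite lee_fin sqr_ge0. Qed.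

Let q_le N y : midconvex g N y -> (q y <= mu setT)%E.
Proof.
move=> cy; rewrite -[leRHS]mul1e -integral_cst//.
apply: ge0_le_integral => //.
- by move=> s _; rewrite lee_fin sqr_ge0.
- apply/measurable_EFinP; apply: measurable_funX.
  exact: midconvex_measurable cy.
- move=> s _; rewrite lee_fin -real_normK ?num_real// -[leRHS](expr1n _ 2).
  by rewrite lerXn2r ?nnegrE//; exact: midconvex_le1 cy.
Qed.

Let q_fin N y : midconvex g N y -> q y \is a fin_num.
Proof.
move=> /q_le h; rewrite ge0_fin_numE//; apply: le_lt_trans h _.
by rewrite ltey_eq fin_num_measure.
Qed.

Let q_parallelogram N y z : midconvex g N y -> midconvex g N z ->
  (q (fun s => y s - z s)%R + 4%:E * q (fun s => (y s + z s) / 2)%R =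
   2%:E * q y + 2%:E * q z)%E.
Proof.
move=> cy cz; have my := midconvex_measurable cy.
have mz := midconvex_measurable cz.
have mE (f : T -> R) : measurable_fun setT f ->
    measurable_fun setT (fun s => ((f s) ^+ 2)%:E).
  by move=> mf; apply/measurable_EFinP; exact: measurable_funX.
have mZ (k : R) (f : T -> R) : measurable_fun setT f ->
    measurable_fun setT (fun s => (k%:E * ((f s) ^+ 2)%:E)%E).
  by move=> mf; apply: measurable_funeM; exact: mE.
have s0 (f : T -> R) : forall s, setT s -> (0 <= ((f s) ^+ 2)%:E)%E.
  by move=> s _; rewrite lee_fin sqr_ge0.
have myz : measurable_fun setT (fun s => y s - z s) by exact: measurable_funB.
have mm : measurable_fun setT (fun s => (y s + z s) / 2).
  by apply: measurable_funM => //; exact: measurable_funD.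
rewrite /q -!ge0_integralZl_EFin//; try exact: mE.
rewrite -!ge0_integralD//; try (by move=> s _; rewrite mule_ge0// lee_fin// sqr_ge0).
- by apply: eq_integral => s _; rewrite -!EFinM -!EFinD; congr EFin; field.
- exact: mZ.
- exact: mZ.
- exact: (s0 (fun s => y s - z s)).
- exact: (mE (fun s => y s - z s)).
- exact: (mZ 4 (fun s => (y s + z s) / 2)).
- exact: s0.
- exact: s0.
- exact: (s0 (fun s => (y s + z s) / 2)).
Qed.

(* By the parallelogram identity, midpoint-convex combinations whose L2 norm is
   nearly minimal on their tails are close to each other. *)
Lemma midconvex_almost_cvg (x : R) : 0 < x ->
  exists (y : nat -> T -> R) (E : set T),
    [/\ forall j, midconvex g j (y j), measurable E, (mu E <= x%:E)%E &
        forall s, ~ E s -> forall j, `|y j s - y 0%N s| <= 1 / 4].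
Proof.
move=> x0.
(* The thresholds [a j] sum to 1/4, and [eta j] is such that Markov's inequality at level [a j ^+ 2]
   turns the bound 8 eta j on the squared distance into x / 2 ^ j.+1. *)
pose a j : R := (2 ^ (j + 3))%:R^-1.
have a0 j : 0 < a j by rewrite invr_gt0 ltr0n expn_gt0.
pose eta j : R := x / (2 ^ j.+1)%:R * a j ^+ 2 / 8.
have eta0 j : 0 < eta j.
  by rewrite !mulr_gt0// ?invr_gt0 ?ltr0n ?expn_gt0// exprn_gt0.
have etadec j : eta j.+1 <= eta j.
  rewrite /eta ler_pM2r// ler_pM ?sqr_ge0//.
  - by rewrite mulr_ge0// ?invr_ge0// ltW.
  - rewrite ler_pM2l// lef_pV2 ?posrE ?ltr0n ?expn_gt0// ler_nat.
    by rewrite leq_exp2l.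
  - apply: lerXn2r; rewrite ?nnegrE ?(ltW (a0 _))//.
    rewrite /a lef_pV2 ?posrE ?ltr0n ?expn_gt0// ler_nat.
    by rewrite leq_exp2l.
have [||||M [y hy]] := @almost_minimizers R (T -> R) (midconvex g) (fine \o q)
   (fine (mu setT)) eta.
- by move=> N; exists (g N); exact: midconvex_base.
- exact: midconvex_mono.
- move=> N y cy; rewrite /= fine_ge0//= fine_le//.
  + exact: q_fin cy.
  + exact: fin_num_measure.
  + exact: q_le cy.
- by [].
pose Bad j := [set s | a j <= `|y j s - y j.+1 s|].
have cM j : midconvex g (M j) (y j) by have [] := hy j.
have cM1 j : midconvex g (M j) (y j.+1).
  have [/andP[_ h] _ _] := hy j; exact: midconvex_mono h _ (cM j.+1).
have mB j : measurable_fun setT (fun s => y j s - y j.+1 s).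
  by apply: measurable_funB; apply: midconvex_measurable; exact: cM.
have mBad j : measurable (Bad j).
  by apply: (@measurable_set_ler _ _ _ (cst (a j))) => //; exact: measurableT_comp.
(* The midpoint of [y j] and [y j.+1] is still in [midconvex g (M j)]; near minimality of both
   against it bounds the left side by 4 eta j + 2 eta j.+1. *)
have qd j : (q (fun s => (y j s - y j.+1 s)%R) <= (8 * eta j)%:E)%E.
  have := q_parallelogram (cM j) (cM1 j).
  have cmid := midconvex_mid (cM j) (cM1 j).
  have [_ _ /(_ _ cmid)] := hy j => /=.
  have := etadec j.
  have : q (fun s => (y j s - y j.+1 s)%R) \is a fin_num \/
         q (fun s => (y j s - y j.+1 s)%R) = +oo%E.
    by have := q_ge0 (fun s => (y j s - y j.+1 s)%R); case: (q _) => //= *; [left|right].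
  have := q_fin (cM j); have := q_fin (cM1 j); have := q_fin cmid.
  move=> /fineK; set m := fine _; move=> <- /fineK; set u := fine _; move=> <-.
  move=> /fineK; set v := fine _; move=> <- [|->//].
  move=> /fineK; set w := fine _; move=> <-; rewrite -!EFinM -!EFinD !lee_fin.
  by have := eta0 j; move=> h0 h1 [h2 h3] [h4]; lra.
have hBad j : (mu (Bad j) <= (x / (2 ^ j.+1)%:R)%:E)%E.
  have : (mu (Bad j) * (a j ^+ 2)%:E <= q (fun s => (y j s - y j.+1 s)%R))%E.
    rewrite (_ : Bad j = [set s | a j ^+ 2 <= (y j s - y j.+1 s) ^+ 2]).
      apply: markov_le_integral; first by rewrite exprn_gt0.
        exact: measurable_funX.
      by move=> s; exact: sqr_ge0.
    apply/seteqP; split=> s /=; rewrite -(real_normK (num_real (y j s - _))).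
      by rewrite ler_sqr ?nnegrE// ltW.
    by rewrite ler_sqr ?nnegrE// ltW.
  move=> /le_trans /(_ (qd j)).
  have <- : (x / (2 ^ j.+1)%:R * a j ^+ 2) = 8 * eta j by rewrite /eta; field.
  by rewrite (EFinM (x / _)) lee_pmul2r// lte_fin exprn_gt0.
exists y, (\bigcup_j Bad j); split.
- by move=> j; have [/andP[h _] _ _] := hy j; exact: midconvex_mono h _ (cM j).
- exact: bigcup_measurable.
- by apply: measure_bigcup_small => //; exact: ltW.
- move=> s nE.
  have nB i : `|y i.+1 s - y i s| <= a i.
    rewrite distrC ltW// ltNge; apply/negP => h; apply: nE; by exists i.
  (* The right side is the sum of the thresholds [a i] for i < j. *)
  suff H j : `|y j s - y 0%N s| <= 1 / 4 - (2 ^ (j + 2))%:R^-1.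
    by move=> j; apply: le_trans (H j) _; rewrite gerBl invr_ge0.
  elim: j => [|j IH]; first
    by rewrite subrr normr0 div1r (_ : (2 ^ (0 + 2))%:R = 4 :> R)// subrr.
  rewrite -(subrKA (y j s)) (le_trans (ler_normD _ _))//.
  apply: le_trans (lerD (nB j) IH) _; rewrite /a.
  rewrite addSn (_ : j + 3 = (j + 2).+1)%N; last by rewrite addnS.
  rewrite expnS natrM invfM.
  by set b := (2 ^ (j + 2))%:R^-1; lra.
Qed.

End CommonTimes.

Section FiniteSum.
Context d (T : measurableType d) (R : realType).
Variables m1 m2 : {finite_measure set T -> \bar R}.

Let fin_num_measure_add : fin_num_fun (measure_add m1 m2).
Proof.
by move=> A mA; rewrite measure_addE fin_numD !fin_num_measure.
Qed.

HB.instance Definition _ := Measure.on (measure_add m1 m2).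
HB.instance Definition _ :=
  @Measure_isFinite.Build _ _ _ (measure_add m1 m2) fin_num_measure_add.

End FiniteSum.

(** The function 1 - g n vanishes on [U n] and is at most 2 elsewhere, so its integral is at most 2
    x. Midpoints keep this bound, and Markov's inequality at level 1/4 gives 8 x. *)
Lemma midconvex_large d (T : measurableType d) (R : realType)
    (mu : {finite_measure set T -> \bar R}) (g : nat -> T -> R)
    (U : nat -> set T) (x : R) N y :
  (forall n, measurable_fun setT (g n)) -> (forall n s, `|g n s| <= 1) ->
  (forall n, measurable (U n)) -> (forall n, (mu (~` U n) <= x%:E)%E) ->
  (forall n s, U n s -> g n s = 1) ->
  midconvex g N y -> (mu [set s | (1 / 4 <= 1 - y s)%R] <= (8 * x)%:E)%E.
Proof.
move=> mg g1 mU muU gU cy.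
have p0 z : midconvex g N z -> forall s, 0 <= 1 - z s.
  by move=> cz s; have := midconvex_le1 g1 s cz; rewrite ler_norml; lra.
have mm z : midconvex g N z -> measurable_fun setT (fun s => (1 - z s)%:E).
  move=> cz; apply/measurable_EFinP; apply: measurable_funB => //.
  exact: midconvex_measurable cz.
have H : (\int[mu]_s (1 - y s)%R%:E <= (2 * x)%R%:E)%E.
  elim: cy => [n Nn|{}y z cy hy cz hz].
    have nU : measurable (~` U n) by exact: measurableC.
    apply: (@le_trans _ _ (\int[mu]_s (2%:E * (\1_(~` U n) s)%:E))%E).
      apply: ge0_le_integral => //.
      - by move=> s _; rewrite lee_fin; apply: p0; exact: midconvex_base.
      - by apply: mm; exact: midconvex_base.
      - by apply: measurable_funeM; exact/measurable_EFinP.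
      move=> s _; rewrite -EFinM lee_fin indicE in_setC.
      have [/set_mem/gU ->|_] := boolP (s \in U n).
        by rewrite subrr mulr0.
      by have := g1 n s; rewrite ler_norml mulr1; lra.
    rewrite ge0_integralZl_EFin//; [|exact/measurable_EFinP].
    by rewrite integral_indic// setIT EFinM lee_pmul2l ?lte_fin//; exact: muU.
  have -> : (\int[mu]_s (1 - (y s + z s) / 2)%:E =
      (2^-1)%:E * \int[mu]_s (1 - y s)%:E + (2^-1)%:E * \int[mu]_s (1 - z s)%:E)%E.
    have h0 : (0 <= 2^-1 :> R) by rewrite invr_ge0.
    rewrite -!ge0_integralZl_EFin//; try exact: mm;
      try by move=> s _; rewrite lee_fin; exact: p0.
    rewrite -ge0_integralD//.
    - by apply: eq_integral => s _; rewrite -!EFinM -EFinD; congr EFin; field.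
    - by move=> s _; rewrite -EFinM lee_fin mulr_ge0// p0.
    - by apply: measurable_funeM; exact: mm.
    - by move=> s _; rewrite -EFinM lee_fin mulr_ge0// p0.
    - by apply: measurable_funeM; exact: mm.
  rewrite (_ : 2 * x = 2^-1 * (2 * x) + 2^-1 * (2 * x)); last by field.
  rewrite EFinD (EFinM 2^-1); apply: leeD;
    rewrite lee_pmul2l ?lte_fin ?invr_gt0//.
have m1y : measurable_fun setT (fun s => 1 - y s).
  by apply: measurable_funB => //; exact: midconvex_measurable cy.
rewrite -(@lee_pmul2r _ (1 / 4)%:E) ?lte_fin//.
rewrite -EFinM (_ : 8 * x * (1 / 4) = 2 * x); last by field.
by apply: le_trans H; apply: markov_le_integral => //; exact: p0.
Qed.

(** For typical s1 and s2 one has y 0 s1 > 3/4 and y 0 s2 < -3/4, while y N stays within 1/4 of y 0.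
    Hence y N s1 - y N s2 > 1, so g n s1 - g n s2 > 1 for some n >= N; as g n takes the values -1,
    0, 1, this forces the values 1 at s1 and -1 at s2. The sets T1 and T2 are chosen before any
    pairing of s1 with s2. *)
Lemma common_times d (T : measurableType d) (R : realType)
    (m1 m2 : {finite_measure set T -> \bar R}) (U V : nat -> set T) (x : R) :
  0 < x -> (forall n, measurable (U n)) -> (forall n, measurable (V n)) ->
  (forall n s, U n s -> ~ V n s) ->
  (forall n, (m1 (~` U n) <= x%:E)%E) -> (forall n, (m2 (~` V n) <= x%:E)%E) ->
  exists T1 T2 : set T, [/\ measurable T1 /\ measurable T2,
    (m1 (~` T1) <= (9 * x)%:E)%E, (m2 (~` T2) <= (9 * x)%:E)%E &
    forall s1 s2, T1 s1 -> T2 s2 -> forall N,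
      exists n, [/\ (N <= n)%N, U n s1 & V n s2]].
Proof.
move=> x0 mU mV UV m1U m2V.
pose g n s : R := \1_(U n) s - \1_(V n) s.
have gU n s : U n s -> g n s = 1.
  move=> Us; rewrite /g !indicE mem_set// memNset ?subr0//; exact: UV Us.
have gV n s : V n s -> g n s = -1.
  move=> Vs; rewrite /g !indicE (mem_set Vs) memNset ?sub0r// => Us.
  exact: UV Us Vs.
have g0 n s : ~ U n s -> ~ V n s -> g n s = 0.
  by move=> h1 h2; rewrite /g !indicE !memNset// subrr.
have gcase n s : [\/ U n s /\ g n s = 1, V n s /\ g n s = -1 | g n s = 0].
  have [Us|nU] := pselect (U n s); first by constructor 1; split => //; exact: gU.
  have [Vs|nV] := pselect (V n s); first by constructor 2; split => //; exact: gV.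
  by constructor 3; exact: g0.
have g1 n s : `|g n s| <= 1.
  by have [[_ ->]|[_ ->]|->] := gcase n s; rewrite ?normrN ?normr1 ?normr0.
have mg n : measurable_fun setT (g n).
  by apply: measurable_funB; exact: measurable_indic.
(* Working with m1 + m2 yields one sequence y and one exceptional set E for both measures. *)
have [y [E [cy mE muE hE]]] :=
  @midconvex_almost_cvg _ _ _ g mg g1 (measure_add m1 m2) _ x0.
have my : measurable_fun setT (y 0%N) by exact: midconvex_measurable (cy 0%N).
have mB1 : measurable [set s | 1 / 4 <= 1 - y 0%N s].
  by apply: (@measurable_set_ler _ _ _ (cst _)) => //; exact: measurable_funB.
have mB2 : measurable [set s | 1 / 4 <= 1 - - y 0%N s].
  apply: (@measurable_set_ler _ _ _ (cst _)) => //; apply: measurable_funB => //.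
  exact: measurableT_comp.
have muE1 : (m1 E <= x%:E)%E.
  by apply: le_trans muE; have /= -> := measure_addE m1 m2 E; exact: leeDl.
have muE2 : (m2 E <= x%:E)%E.
  by apply: le_trans muE; have /= -> := measure_addE m1 m2 E; exact: leeDr.
exists (~` ([set s | 1 / 4 <= 1 - y 0%N s] `|` E)),
       (~` ([set s | 1 / 4 <= 1 - - y 0%N s] `|` E)); split.
- by split; apply: measurableC; exact: measurableU.
- rewrite setCK (le_trans (measureU2 _ _ _))//.
  rewrite (_ : 9 * x = 8 * x + x); last by ring.
  rewrite EFinD; apply: leeD => //.
  by apply: (@midconvex_large _ _ _ m1 g U x 0%N).
- rewrite setCK (le_trans (measureU2 _ _ _))//.
  rewrite (_ : 9 * x = 8 * x + x); last by ring.
  rewrite EFinD; apply: leeD => //.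
  apply: (@midconvex_large _ _ _ m2 (fun n s => - g n s) V x 0%N
    (fun s => - y 0%N s)) => //.
  + by move=> n; exact: measurableT_comp.
  + by move=> n s; rewrite normrN.
  + by move=> n s /gV ->; rewrite opprK.
  elim: (cy 0%N) => [n _|{}a b _ ha _ hb].
    exact: (@midconvex_base _ _ _ (fun n s => - g n s)).
  rewrite (_ : (fun s => _) = (fun s => (- a s + - b s) / 2)).
    exact: midconvex_mid.
  by apply/funext => s; field.
- move=> s1 s2 /not_orP[/negP + /hE h1] /not_orP[/negP + /hE h2] N.
  rewrite -!ltNge => b1 b2.
  have [n Nn hn] := midconvex_diff s1 s2 (cy N).
  move: (h1 N) (h2 N); rewrite !ler_norml => c1 c2.
  have {hn} : 1 < g n s1 - g n s2 by apply: lt_le_trans hn; lra.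
  have [[Us1 ->]|[_ ->]|->] := gcase n s1; have [[_ ->]|[Vs2 ->]|->] := gcase n s2 => h;
  by [exists n|exfalso; lra].
Qed.

(** * Selecting points with equal codes *)

Definition bit_events : set (set (nat -> bool)) :=
  [set H | exists m, H = [set y : nat -> bool | y m]].

Notation bits := (g_sigma_algebraType bit_events).

(** Stands for the random variable generated by the events [A m]; points of two different spaces are
    compared through their codes. *)
Definition bit_code T (A : nat -> set T) (t : T) : nat -> bool :=
  fun m => `[< A m t >].

Lemma measurable_bit_code d (T : measurableType d) (A : nat -> set T) :
  (forall m, measurable (A m)) ->
  measurable_fun setT (bit_code A : T -> bits).
Proof.
move=> mA; apply: (@measurability _ _ T bits setT (bit_code A) bit_events) => //.
move=> _ [_ [m ->] <-]; rewrite setTI.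
rewrite (_ : _ @^-1` _ = A m)//.
by apply/seteqP; split=> t /=; rewrite /bit_code => /asboolP.
Qed.

Lemma measurable_bit_code_preimage d (T : measurableType d) (A : nat -> set T)
    (H : set bits) :
  (forall m, measurable (A m)) -> measurable H -> measurable (bit_code A @^-1` H).
Proof. by move=> mA; apply: measurable_preimage (measurable_bit_code mA). Qed.

(** The event depends on the first n bits only, whatever F and Q are; the induction splits Q
    according to the last of these bits. *)
Lemma measurable_bits_prefix U (F : nat -> set U) (Q : set U) n :
  measurable ([set y : nat -> bool | exists2 x, Q x &
                forall m, (m < n)%N -> y m = `[< F m x >]] : set bits).
Proof.
elim: n Q => [|n IH] Q.
  have [[x Qx]|nQ] := pselect (Q !=set0).
    rewrite (_ : [set _ | _] = setT); first exact: measurableT.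
    by apply/seteqP; split=> y // _; exists x.
  rewrite (_ : [set _ | _] = set0); first exact: measurable0.
  by apply/seteqP; split=> y // [x Qx _]; apply: nQ; exists x.
have mb : measurable ([set y : nat -> bool | y n] : set bits).
  by apply: sub_sigma_algebra; exists n.
rewrite (_ : [set _ | _] =
  ([set y : nat -> bool | y n] `&` [set y : nat -> bool | exists2 x, (Q `&` F n) x &
                forall m, (m < n)%N -> y m = `[< F m x >]]) `|`
  (~` [set y : nat -> bool | y n] `&` [set y : nat -> bool | exists2 x, (Q `&` ~` F n) x &
                forall m, (m < n)%N -> y m = `[< F m x >]])).
  apply: measurableU; apply: measurableI => //; try exact: IH.
  exact: measurableC.
apply/seteqP; split=> y /=.
- move=> [x Qx h]; have hn := h n (ltnSn n).
  have [Fx|nFx] := pselect (F n x).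
    left; split; first by rewrite hn; exact/asboolP.
    by exists x => // m mn; apply: h; exact: ltnW.
  right; split; first by rewrite hn => /asboolP.
  by exists x => // m mn; apply: h; exact: ltnW.
- move=> [[yn [x [Qx Fx] h]]|[yn [x [Qx Fx] h]]]; exists x => // m;
    rewrite ltnS leq_eqVlt => /orP[/eqP ->|]; try exact: h.
  + by rewrite yn; apply/esym/asboolP.
  + by move/negP/negbTE: yn => ->; apply/esym/asboolP.
Qed.

Section Selection.
Context d (T : measurableType d) (R : realType) (U : topologicalType).
Variables (c : T -> U) (mu : {finite_measure set T -> \bar R}).

(* T has no topology of its own: closed and compact sets are those pulled back
   along c. *)
Definition closed_regular := forall W, measurable W -> forall x : R, 0 < x ->
  exists F : set U, [/\ closed F, measurable (c @^-1` F), c @^-1` F `<=` W &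
    (mu (W `\` c @^-1` F) <= x%:E)%E].

(** Placing Q inside the range of c makes cluster points found in U come from points of T. *)
Definition tight := forall x : R, 0 < x ->
  exists Q : set U, [/\ compact Q, Q `<=` range c, measurable (c @^-1` Q) &
    (mu (~` (c @^-1` Q)) <= x%:E)%E].

Hypotheses (reg : closed_regular) (tgt : tight).
Variables (A : nat -> set T) (W : set T).
Hypotheses (mA : forall m, measurable (A m)) (mW : measurable W)
  (muW : mu (~` W) = 0%E).

(* As in Lusin's theorem, the sets A m become relatively clopen on a compact Q'
   of almost full measure, so the codes taken on Q' form a set that is closed,
   hence an intersection of events on prefixes. *)
Lemma code_image_approx (x : R) : 0 < x ->
  exists H : set bits, [/\ measurable H,
    (forall y, H y -> exists2 t, W t & bit_code A t = y) &
    (mu (~` (bit_code A @^-1` H)) <= x%:E)%E].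
Proof.
(* Budget: [e 0] for the compact set, [e 1] for W, and [e m.+3] for each of [A m] and its
   complement, which together make [e m.+2]. *)
move=> x0; pose e i : R := x / (2 ^ i.+1)%:R.
have e0 i : 0 < e i by rewrite divr_gt0// ltr0n expn_gt0.
have [Q [cQ Qc mQ muQ]] := tgt (e0 0%N).
have [FW [cFW mFW FWW muFW]] := reg mW (e0 1%N).
have /choice[F hF] m := reg (mA m) (e0 m.+3).
have /choice[F' hF'] m := reg (measurableC (mA m)) (e0 m.+3).
pose Q' := Q `&` FW `&` \bigcap_m (F m `|` F' m).
have Q'c u : Q' u -> exists t, [/\ u = c t, W t &
    forall m, F m u /\ A m t \/ ~ F m u /\ F' m u /\ ~ A m t].
  move=> [[Qu FWu] FFu]; have [t _ tu] := Qc _ Qu; exists t; split => //.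
    by apply: FWW; rewrite /= tu.
  move=> m; have [Fu|F'u] := FFu m Logic.I.
    by left; split => //; have [_ _ + _] := hF m; apply; rewrite /= tu.
  have nA : ~ A m t by have [_ _ + _] := hF' m; apply; rewrite /= tu.
  right; split => //; move=> Fu; apply: nA.
  by have [_ _ + _] := hF m; apply; rewrite /= tu.
pose D (y : nat -> bool) n :=
  [set u | Q' u /\ forall m, (m < n)%N -> y m = `[< F m u >]].
pose H : set bits := \bigcap_n
  [set y : nat -> bool | exists2 u, Q' u & forall m, (m < n)%N -> y m = `[< F m u >]].
have mH : measurable H.
  by apply: bigcapT_measurable => n; exact: measurable_bits_prefix.
exists H; split => //.
- move=> y Hy.
  have cQ' : compact Q'.
    rewrite /Q' -setIA; apply: compact_closedI => //; apply: closedI => //.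
    apply: closed_bigI => m _; apply: closedU.
      by have [] := hF m.
    by have [] := hF' m.
  have Dn0 n : D y n !=set0 by have [u Qu hu] := Hy n Logic.I; exists u.
  have Ddec n m : (n <= m)%N -> D y m `<=` D y n.
    by move=> nm u [Qu hu]; split => // k kn; apply: hu; exact: leq_trans nm.
  (* The points of Q' matching longer and longer prefixes of y have a cluster point u in Q';
     closedness of [F m] and [F' m] passes each bit of y on to u. *)
  pose Fl := filter_from (@setT nat) (D y).
  have FlP : ProperFilter Fl.
    apply: filter_from_proper; last by move=> n _; exact: Dn0.
    apply: filter_from_filter; first by exists 0%N.
    move=> n m _ _; exists (maxn n m) => // u Du; split.
      exact: Ddec (leq_maxl n m) _ Du.
    exact: Ddec (leq_maxr n m) _ Du.
  have [|u [Qu clu]] := cQ' Fl FlP; first by exists 0%N => // u [].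
  have cl n : closure (D y n) u by move=> B Bu; apply: clu Bu; exists n.
  have [t [uc Wt ht]] := Q'c _ Qu.
  exists t => //; apply/funext => m; rewrite /bit_code.
  have clm (G : set U) : closed G -> D y m.+1 `<=` G -> G u.
    by move=> cG DG; apply: cG; apply: closure_subset DG _ (cl m.+1).
  have [cF _ _ _] := hF m; have [cF' _ F'A _] := hF' m.
  case ym : (y m).
    apply/asboolP; suff : F m u by case: (ht m) => [[]//|[]].
    by apply: clm => // v [_ /(_ m (ltnSn m))]; rewrite ym => /esym/asboolP.
  apply/asboolP; suff : F' m u by rewrite uc => /F'A.
  apply: clm => // v [Qv /(_ m (ltnSn m))]; rewrite ym => /esym/asboolP nF.
  by have [_ /(_ m Logic.I)[]] := Qv.
- pose B i := match i with
    | 0 => ~` (c @^-1` Q)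
    | 1 => ~` W `|` W `\` c @^-1` FW
    | m.+2 => (A m `\` c @^-1` F m) `|` (~` A m `\` c @^-1` F' m)
    end.
  have mF m : measurable (c @^-1` F m) by have [] := hF m.
  have mF' m : measurable (c @^-1` F' m) by have [] := hF' m.
  have mB i : measurable (B i).
    case: i => [|[|m]] /=; first exact: measurableC.
      by apply: measurableU; [exact: measurableC|exact: measurableD].
    by apply: measurableU; apply: measurableD => //; exact: measurableC.
  apply: (@le_trans _ _ (mu (\bigcup_i B i))).
    apply: le_finite_measure.
    + apply: measurableC; exact: measurable_bit_code_preimage.
    + exact: bigcup_measurable.
    + move=> t nH; apply: contrapT => nB; apply: nH => n _ /=.
      have nBi i : ~ B i t by move=> Bi; apply: nB; exists i.
      exists (c t).
        split; first split.
        * by have /= := nBi 0%N; move/contrapT.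
        * have /= /not_orP[/contrapT Wt] := nBi 1%N.
          by move=> h; apply: contrapT => nF; apply: h; split.
        move=> m _; have /= /not_orP[h1 h2] := nBi m.+2.
        have [At|nAt] := pselect (A m t).
          by left; apply: contrapT => nF; apply: h1.
        by right; apply: contrapT => nF; apply: h2.
      move=> m _; have /= /not_orP[h1 h2] := nBi m.+2.
      rewrite /bit_code; apply/asboolP/asboolP => [At|Ft].
        by apply: contrapT => nF; apply: h1.
      by have [_ _ + _] := hF m; apply.
  apply: measure_bigcup_small => //; first exact: ltW.
  case=> [|[|m]] //=.
    apply: le_trans (measureU2 _ _ _) _; try exact: measurableC.
      exact: measurableD.
    by have /= -> := muW; rewrite add0e.
  apply: le_trans (measureU2 _ _ _) _; try exact: measurableD.
    by apply: measurableD => //; exact: measurableC.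
  have -> : x / (2 ^ m.+3)%:R = e m.+3 + e m.+3.
    rewrite /e (expnS 2 m.+3) natrM; field.
    by rewrite pnatr_eq0 expn_eq0.
  by rewrite EFinD; apply: leeD; [have [] := hF m|have [] := hF' m].
Qed.

Lemma code_image_full : exists H : set bits, [/\ measurable H,
    (forall y, H y -> exists2 t, W t & bit_code A t = y) &
    mu (~` (bit_code A @^-1` H)) = 0%E].
Proof.
have n0 (i : nat) : 0 < i.+1%:R^-1 :> R by [].
have /choice[H hH] i := code_image_approx (n0 i).
have mH : measurable (\bigcup_i H i).
  by apply: bigcup_measurable => i _; have [] := hH i.
have mcode (K : set bits) : measurable K -> measurable (bit_code A @^-1` K).
  exact: measurable_bit_code_preimage.
exists (\bigcup_i H i); split => //.
  by move=> y [i _ Hy]; have [_ + _] := hH i; exact.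
apply/eqP; rewrite eq_le measure_ge0 andbT.
apply/lee_addgt0Pr => x x0; rewrite add0e.
have [n nx] : exists n : nat, n.+1%:R^-1 < x.
  have [n] := near_infty_natSinv_lt (PosNum x0).
  by move=> _ /(_ n (leqnn _)); exists n.
have [mHn _ hn] := hH n.
apply: (@le_trans _ _ (mu (~` (bit_code A @^-1` H n)))).
  apply: le_finite_measure; try by apply: measurableC; exact: mcode.
  by apply: subsetC => t Ht; exists n.
by apply: le_trans hn _; rewrite lee_fin ltW.
Qed.

End Selection.

(** [H1] and [H2] consist of codes attained on W1 and W2 and have full measure for the respective
    code laws. Absolute continuity makes [H1] full for the second law as well, so the two sets share
    a code. *)
Lemma code_selection d1 d2 (T1 : measurableType d1) (T2 : measurableType d2)
    (R : realType) (U1 U2 : topologicalType) (c1 : T1 -> U1) (c2 : T2 -> U2)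
    (m1 : {finite_measure set T1 -> \bar R})
    (m2 : {finite_measure set T2 -> \bar R})
    (A1 : nat -> set T1) (A2 : nat -> set T2) (W1 : set T1) (W2 : set T2) :
  closed_regular c1 m1 -> tight c1 m1 -> closed_regular c2 m2 -> tight c2 m2 ->
  (forall m, measurable (A1 m)) -> (forall m, measurable (A2 m)) ->
  measurable W1 -> measurable W2 -> m1 (~` W1) = 0%E -> m2 (~` W2) = 0%E ->
  m2 setT != 0%E ->
  (forall H : set bits, measurable H ->
     m1 (bit_code A1 @^-1` H) = 0%E -> m2 (bit_code A2 @^-1` H) = 0%E) ->
  exists t1 t2, [/\ W1 t1, W2 t2 & bit_code A1 t1 = bit_code A2 t2].
Proof.
move=> r1 i1 r2 i2 mA1 mA2 mW1 mW2 nW1 nW2 m20 ac.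
have [H1 [mH1 h1 H10]] := code_image_full r1 i1 mA1 mW1 nW1.
have [H2 [mH2 h2 H20]] := code_image_full r2 i2 mA2 mW2 nW2.
have H12 := ac _ (measurableC mH1) H10.
have mcode (K : set bits) : measurable K -> measurable (bit_code A2 @^-1` K).
  exact: measurable_bit_code_preimage.
suff [t [Ht1 Ht2]] : exists t, H1 (bit_code A2 t) /\ H2 (bit_code A2 t).
  have [t1 W1t e1] := h1 _ Ht1; have [t2 W2t e2] := h2 _ Ht2.
  by exists t1, t2; rewrite e1 e2.
apply: contrapT => /forallNP nt; move/eqP: m20; apply.
apply/eqP; rewrite eq_le measure_ge0 andbT.
apply: (@le_trans _ _ (m2 (bit_code A2 @^-1` (~` H1) `|` ~` (bit_code A2 @^-1` H2)))).
  apply: le_finite_measure => //.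
    by apply: measurableU; [apply: mcode; exact: measurableC|
      apply: measurableC; exact: mcode].
  move=> t _; have /not_andP[h|h] := nt t; by [left|right].
apply: le_trans (measureU2 _ _ _) _.
- by apply: mcode; exact: measurableC.
- by apply: measurableC; exact: mcode.
- by have /= -> := H12; have /= -> := H20; rewrite adde0.
Qed.

(** * Borel probability on Hilbert space *)

Lemma closed_borel_measurable (T : ptopologicalType) (F : set T) :
  closed F -> measurable (F : set (borel T)).
Proof.
move=> cF; rewrite -(setCK F); apply: measurableC.
by apply: sub_sigma_algebra; exact: closed_openC.
Qed.

Lemma continuous_borel_measurable (T U : ptopologicalType) (f : T -> U) :
  continuous f -> measurable_fun setT (f : borel T -> borel U).
Proof.
move=> cf; apply: (@measurability _ _ (borel T) (borel U) setT f (@open U)) => //.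
move=> _ [B oB <-]; rewrite setTI.
by apply: sub_sigma_algebra; apply: open_comp => // x _; exact: cf.
Qed.

Section NormedBorel.
Context (R : realType) (X : normedModType R).

Lemma closed_far (B : set X) (r : R) :
  closed [set x | forall y, B y -> r <= `|x - y|].
Proof.
rewrite (_ : mkset _ = \bigcap_(y in B) [set x | r <= `|x - y|]); last first.
  by apply/seteqP; split=> x h y; exact: h.
apply: closed_bigI => y _.
apply: (@preimage_closed _ _ (fun x => `|x - y|) [set z | r <= z]); last exact: closed_ge.
move=> x _; apply: cvg_norm; apply: cvgB; [exact: cvg_id|exact: cvg_cst].
Qed.

(** Writes an open set as a countable union of closed sets, the form required by
    [inner_approx_bigcup]. *)
Lemma open_bigcup_far (B : set X) : open B ->
  B = \bigcup_n [set x | forall y, ~ B y -> n.+1%:R^-1 <= `|x - y|].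
Proof.
move=> oB; apply/seteqP; split=> [x Bx|x [n _ h]].
  move: oB; rewrite openE => /(_ x Bx) /nbhs_ballP [r /= r0 hr].
  have [n _ /(_ n (leqnn _)) /= nr] := near_infty_natSinv_lt (PosNum r0).
  exists n => // y nBy; apply: le_trans (ltW nr) _; rewrite leNgt.
  by apply/negP => xy; apply: nBy; apply: hr; rewrite -ball_normE.
apply: contrapT => nBx; have := h x nBx.
by rewrite subrr normr0 leNgt invr_gt0 ltr0n.
Qed.

Lemma borel_closed_regular (mu : {finite_measure set (borel X) -> \bar R}) :
  closed_regular (id : borel X -> X) mu.
Proof.
move=> W mW x x0.
have cm (F : set X) : closed F -> measurable (F : set (borel X)).
  exact: closed_borel_measurable.
have [||||||F [cF FW muF]] := @inner_approx_sigma _ (borel X) R mu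
  (@closed X) cm _ _ _ _ (@open X) _ _ W mW x x0.
- exact: closed0.
- exact: closedT.
- by move=> A B; exact: closedU.
- by move=> A hA; apply: closed_bigI.
- by move=> B oB; exact: sub_sigma_algebra.
- move=> B oB; split; last first.
    by apply: inner_approx_refl; exact: open_closedC.
  rewrite (open_bigcup_far oB); apply: inner_approx_bigcup => //.
  + exact: closed0.
  + by move=> A C; exact: closedU.
  + by move=> i; apply: cm; exact: closed_far.
  + by move=> i; apply: inner_approx_refl; exact: closed_far.
- by exists F; split => //; exact: cm.
Qed.

End NormedBorel.

Section Hilbert.
Context (R : realType) (X : completeNormedModType R).
Variables (dot : {dot X for idfun}) (e : nat -> X).
Hypothesis basis_e : hilbert_basis dot e.

(** One-term Bessel inequality: expand the squared norm of the component of x orthogonal to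
    [e k]. *)
Lemma dot_basis_le x k : `|dot x (e k)| <= `|x|.
Proof.
have [nx ee _] := basis_e.
have sym u v : dot u v = dot v u by rewrite (hermC dot) /= expr0 mul1r.
rewrite -(@ler_pXn2r _ 2)// ?nnegrE//.
have /(_ (x - dot x (e k) *: e k)) := nx.
rewrite linearBl !linearBr !linearZr_LR !linearZl_LR /= -nx.
rewrite (sym (e k) x) linearZr_LR /= ee eqxx mulr1 subrr subr0.
move=> h; rewrite real_normK ?num_real//; have := sqr_ge0 `|x - dot x (e k) *: e k|.
by rewrite h expr2; lra.
Qed.

Lemma dot_basis_continuous k : continuous (fun x => dot x (e k)).
Proof.
move=> x; apply/cvgrPdist_le => eps eps0; near=> y.
rewrite -linearBl; apply: le_trans (dot_basis_le _ _) _.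
by near: y; apply: cvgr_dist_le => //; exact: cvg_id.
Unshelve. all: by end_near. Qed.

Lemma cvg_sumZ (Y : Type) (F : set_system Y) (a : nat -> R) (c : nat -> Y -> R) i :
  Filter F -> (forall k, c k y @[y --> F] --> a k) ->
  (\sum_(k < i) c k y *: e k) @[y --> F] --> \sum_(k < i) a k *: e k.
Proof.
move=> FF ca; elim: i => [|i IH].
  rewrite big_ord0; under eq_cvg do rewrite big_ord0; exact: cvg_cst.
rewrite big_ord_recr /=; under eq_cvg do rewrite big_ord_recr /=.
by apply: cvgD => //; exact: cvgZr_tmp.
Qed.

Let T (i : nat) (x : nat -> R) : X := \sum_(k < i) x k *: e k.

(* The Cauchy condition on the partial sums, with an explicit modulus, is closed
   under coordinatewise convergence. *)
Let K (rho : nat -> nat) : set (prod_topology (fun _ : nat => R)) :=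
  [set x | forall n, (`|x n| <= (rho n)%:R) /\
     forall i j, (rho n <= i)%N -> (rho n <= j)%N ->
       `|T i x - T j x| <= n.+1%:R^-1].

Let T_continuous i : continuous (T i : prod_topology (fun _ : nat => R) -> X).
Proof.
move=> x; pose Y := prod_topology (fun _ : nat => R).
apply: (@cvg_sumZ Y (nbhs (x : Y)) x (fun k y => y k) i (nbhs_filter (x : Y))) => k.
exact: (@proj_continuous _ (fun _ : nat => R) k).
Qed.

(** Tychonoff handles the coordinate bounds; each modulus condition involves finitely many
    coordinates and is therefore closed in the product topology. *)
Lemma K_compact rho : compact (K rho).
Proof.
rewrite (_ : K rho = [set x : prod_topology (fun _ : nat => R) |
    forall n, `[- (rho n)%:R, (rho n)%:R]%classic (x n)] `&`
  \bigcap_n \bigcap_(i in [set i | (rho n <= i)%N])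
    \bigcap_(j in [set j | (rho n <= j)%N])
     [set x | `|T i x - T j x| <= n.+1%:R^-1]); last first.
  apply/seteqP; split=> x.
    move=> h; split=> [n|n _ i hi j hj /=]; have [h1 h2] := h n.
      by rewrite /= in_itv /= -ler_norml.
    exact: h2.
  move=> [h1 h2] n; split; first by have := h1 n; rewrite /= in_itv /= -ler_norml.
  by move=> i j hi hj; exact: (h2 n Logic.I i hi j hj).
apply: compact_closedI.
  by apply: (@tychonoff nat (fun=> R)
    (fun n => `[- (rho n)%:R, (rho n)%:R]%classic)) => n; exact: segment_compact.
apply: closed_bigI => n _; apply: closed_bigI => i _; apply: closed_bigI => j _.
pose Y := prod_topology (fun _ : nat => R).
apply: (@preimage_closed Y R (fun x : Y => `|T i x - T j x|) [set z | z <= n.+1%:R^-1]).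
  move=> x _; apply: (@cvg_norm _ _ _ (nbhs x)).
  by apply: (@cvgB _ _ _ (nbhs x)); exact: T_continuous.
exact: closed_le.
Qed.

Let L (x : nat -> R) : X := lim (T i x @[i --> \oo]).

Let T_cvg rho x : K rho x -> T i x @[i --> \oo] --> L x.
Proof.
move=> Kx; apply/cauchy_cvgP; apply/cauchy_ballP => eps eps0.
have [n _ /(_ n (leqnn _)) /= neps] := near_infty_natSinv_lt (PosNum eps0).
rewrite near_map2; exists ([set i | (rho n <= i)%N], [set i | (rho n <= i)%N]) => /=.
  by split; exists (rho n).
move=> [i j] /= [hi hj]; rewrite -ball_normE /=.
by apply: le_lt_trans neps; have [_] := Kx n; exact.
Qed.

Let L_approx rho x n i : K rho x -> (rho n <= i)%N ->
  `|L x - T i x| <= n.+1%:R^-1.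
Proof.
move=> Kx ni; have cL := T_cvg Kx.
have c : `|T j x - T i x| @[j --> \oo] --> `|L x - T i x|.
  by apply: cvg_norm; apply: cvgB => //; exact: cvg_cst.
apply: (cvgr_to_le c).
exists (rho n) => // j /= nj; have [_] := Kx n; exact.
Qed.

(** On [K rho] the partial sums converge uniformly, at the rate prescribed by rho. *)
Let L_continuous rho : {within K rho, continuous L}.
Proof.
apply/subspace_continuousP => x Kx; apply/cvgrPdist_le => eps eps0.
have eps3 : 0 < eps / 3 by rewrite divr_gt0.
have [n _ /(_ n (leqnn _)) /= neps] := near_infty_natSinv_lt (PosNum eps3).
pose Y := prod_topology (fun _ : nat => R).
have /cvgrPdist_le/(_ _ eps3) := @T_continuous (rho n) (x : Y).
apply: filterS => y h Ky.
have h1 := L_approx Kx (leqnn (rho n)).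
have h2 := L_approx Ky (leqnn (rho n)).
rewrite distrC in h2.
rewrite (_ : L x - L y = (L x - T (rho n) x) + (T (rho n) x - T (rho n) y) +
   (T (rho n) y - L y)); last by rewrite !addrA !subrK.
apply: le_trans (ler_normD _ _) _.
apply: le_trans (lerD (ler_normD _ _) h2) _.
apply: le_trans (lerD (lerD h1 h) (lexx _)) _.
have le3 (q r : R) : q < r / 3 -> q + r / 3 + q <= r by lra.
exact: le3 neps.
Qed.

(** For fixed n the sets [D n r] exhaust X as r grows, so [rho n] can be chosen at cost x / 2 ^
    n.+1. A vector in all [D n (rho n)] is the sum of a coordinate sequence in [K rho], hence lies
    in the compact image of [K rho] under L. *)
Lemma hilbert_tight (mu : {finite_measure set (borel X) -> \bar R}) :
  tight (id : borel X -> X) mu.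
Proof.
move=> x x0; have [_ _ be] := basis_e.
pose co (u : X) : nat -> R := fun k => dot u (e k).
pose D n r : set X := [set u | `|co u n| <= r%:R /\
  forall i j, (r <= i)%N -> (r <= j)%N -> `|T i (co u) - T j (co u)| <= n.+1%:R^-1].
have Tco i : continuous (fun u => T i (co u)).
  move=> u.
  apply: (@cvg_sumZ X (nbhs u) (co u) (fun k v => co v k) i (nbhs_filter u)) => k.
  exact: dot_basis_continuous.
have cD n r : closed (D n r).
  rewrite (_ : D n r = [set u | `|co u n| <= r%:R] `&`
    \bigcap_(i in [set i | (r <= i)%N]) \bigcap_(j in [set j | (r <= j)%N])
     [set u | `|T i (co u) - T j (co u)| <= n.+1%:R^-1]); last first.
    apply/seteqP; split=> u [h1 h2]; split => //.
      by move=> i hi j hj; exact: h2.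
    by move=> i j hi hj; exact: (h2 i hi j hj).
  apply: closedI.
    apply: (@preimage_closed _ _ (fun u => `|co u n|) [set z | z <= _]).
      move=> u _; apply: cvg_norm; exact: dot_basis_continuous.
    exact: closed_le.
  apply: closed_bigI => i _; apply: closed_bigI => j _.
  apply: (@preimage_closed _ _ (fun u => `|T i (co u) - T j (co u)|) [set z | z <= _]).
    move=> u _; apply: cvg_norm; apply: cvgB; exact: Tco.
  exact: closed_le.
have mD n r : measurable (D n r : set (borel X)) by exact: closed_borel_measurable.
have /choice[rho hrho] n : exists r, (mu (~` D n r) <= (x / (2 ^ n.+1)%:R)%:E)%E.
  have xn : 0 < x / (2 ^ n.+1)%:R by rewrite divr_gt0// ltr0n expn_gt0.
  apply: (measure_nonincreasing_small xn).
  - by move=> r; apply: measurableC.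
  - move=> r r' rr; apply/subsetPset/subsetC => u [h1 h2]; split.
      by apply: le_trans h1 _; rewrite ler_nat.
    by move=> i j hi hj; apply: h2; exact: leq_trans rr _.
  - rewrite (_ : \bigcap_i _ = set0) ?measure0// -subset0 => u hu.
    have cu : T i (co u) @[i --> \oo] --> u by exact: be.
    have n2 : 0 < n.+1%:R^-1 / 2 :> R by rewrite divr_gt0.
    have /cvgrPdist_le/(_ _ n2) [N _ hN] := cu.
    pose B := Num.trunc `|co u n|.
    (* N brings the partial sums within half the tolerance of u, and [B.+1] bounds the n-th
       coordinate. *)
    apply: (hu (maxn N B.+1) Logic.I); split.
      apply: (@le_trans _ _ B.+1%:R); last by rewrite ler_nat leq_maxr.
      by rewrite ltW// truncnS_gt.
    move=> i j; rewrite !geq_max => /andP[hi _] /andP[hj _].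
    rewrite (_ : T i (co u) - T j (co u) = (T i (co u) - u) + (u - T j (co u))).
      apply: le_trans (ler_normD _ _) _; rewrite [leRHS]splitr.
      by apply: lerD; [rewrite distrC; exact: hN|exact: hN].
    by rewrite addrA subrK.
have cK : compact (L @` K rho).
  by apply: continuous_compact; [exact: L_continuous|exact: K_compact].
have clK : closed (L @` K rho) by apply: compact_closed => //; exact: norm_hausdorff.
have mK : measurable (L @` K rho : set (borel X)) by exact: closed_borel_measurable.
exists (L @` K rho); split => //.
apply: (@le_trans _ _ (mu (\bigcup_n ~` D n (rho n)))).
  apply: le_finite_measure.
  - exact: measurableC.
  - by apply: bigcup_measurable => n _; exact: measurableC.
  - rewrite -setC_bigcap; apply: subsetC => u hu.
    exists (co u); last by apply/cvg_lim => //; exact: be.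
    by move=> n; exact: (hu n Logic.I).
apply: measure_bigcup_small => //; first exact: ltW.
by move=> n; exact: measurableC.
Qed.

End Hilbert.

(** * Tightness on the space of driving paths *)

Lemma bigcapT_measurable_rat d (T : measurableType d) (F : rat -> set T) :
  (forall q, measurable (F q)) -> measurable (\bigcap_q F q).
Proof.
move=> mF; rewrite -(setCK (\bigcap_q _)) setC_bigcap; apply: measurableC.
by apply: bigcupT_measurable_rat => q; exact: measurableC.
Qed.

Section RealFunctions.
Context (R : realType).

(** Only s is confined to [a, b]. Compactness, in the form of near coverings, extracts one r from
    the local moduli of continuity. *)
Lemma heine (f : R -> R) (a b eps : R) : continuous f -> 0 < eps ->
  exists r : nat, forall s t, a <= s <= b -> `|s - t| < r.+1%:R^-1 ->
    `|f s - f t| <= eps.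
Proof.
move=> cf eps0.
pose P (r : nat) (s : R) := forall t, `|s - t| < r.+1%:R^-1 -> `|f s - f t| <= eps.
have /compact_near_coveringP/(_ nat \oo P _) : compact `[a, b].
  exact: segment_compact.
case=> [x _|r _ /(_ r (leqnn r)) h]; last first.
  by exists r => s t sab; apply: h; rewrite /= in_itv.
have eps2 : 0 < eps / 2 by rewrite divr_gt0.
have /cvgrPdist_le/(_ _ eps2)/nbhs_ballP[d /= d0 hd] := cf x.
have d2 : 0 < d / 2 by rewrite divr_gt0.
have [r _ hr] := near_infty_natSinv_lt (PosNum d2).
exists (ball x (d / 2), [set n | (r <= n)%N]) => /=.
  by split; [exact: nbhsx_ballx|exists r].
move=> [s n] /= [xs rn] t st.
have h1 : `|f x - f s| <= eps / 2.
  by apply: hd; apply: le_ball xs; rewrite ler_pdivrMr// mulr_natr mulr2n lerDl ltW.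
have h2 : `|f x - f t| <= eps / 2.
  apply: hd; rewrite -ball_normE /=; move: xs; rewrite -ball_normE /= => xs.
  rewrite (_ : x - t = (x - s) + (s - t)); last by rewrite addrA subrK.
  apply: le_lt_trans (ler_normD _ _) _; rewrite [ltRHS]splitr ltrD//.
  by apply: lt_trans st _; exact: hr.
rewrite (_ : f s - f t = (f s - f x) + (f x - f t)); last by rewrite addrA subrK.
apply: le_trans (ler_normD _ _) _; rewrite [leRHS]splitr.
by apply: lerD => //; rewrite distrC.
Qed.

(** Turns conditions on all times of a path into countable intersections. *)
Lemma continuous_rat_le (g : R -> R) (O : set R) (b : R) :
  continuous g -> open O -> (forall q : rat, O (ratr q) -> g (ratr q) <= b) ->
  forall t, O t -> g t <= b.
Proof.
move=> cg oO hq t Ot; rewrite leNgt; apply/negP => bgt.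
have nO : O `&` g @^-1` [set z | b < z] !=set0 by exists t.
have oO' : open (O `&` g @^-1` [set z | b < z]).
  by apply: openI => //; apply: open_comp => [z _|]; [exact: cg|exact: open_gt].
have [y [[Oy gy] [q _ qy]]] := @dense_rat R _ nO oO'.
by move: Oy gy; rewrite -qy /= => /hq; rewrite leNgt => /negP.
Qed.

End RealFunctions.

Section PathSpace.
Context (R : realType).

(** Places paths in a product of lines, one for each mode and time, where Tychonoff's theorem is
    available. *)
Definition path_coord (w : Omega R) : prod_topology (fun _ : nat * R => R) :=
  fun p => w p.1 p.2.

Lemma measurable_path_coord k t : measurable_fun setT (fun w : Omega R => w k t).
Proof.
move=> _ A mA; rewrite setTI; apply: sub_sigma_algebra.
by exists k, t, A.
Qed.

Let U := prod_topology (fun _ : nat * R => R).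

Let coord_continuous (p : nat * R) : continuous (fun x : U => x p).
Proof. by move=> x; exact: (@proj_continuous _ (fun _ : nat * R => R) p). Qed.

(** Cylinders over open sets generate the sigma-algebra, and each is a countable union of cylinders
    over closed sets. Measurability is carried along in the class [C] rather than derived for every
    pulled-back closed set. *)
Lemma path_closed_regular (mu : {finite_measure set (Omega R) -> \bar R}) :
  closed_regular path_coord mu.
Proof.
move=> W mW x x0.
pose C := [set S : set (Omega R) | measurable S /\
             exists2 F : set U, closed F & S = path_coord @^-1` F].
pose G := [set S : set (Omega R) | exists k t (O : set R),
             open O /\ S = [set w : wpath R | O (w k t)]].
have Ccoord k t (F : set R) : closed F -> C [set w : wpath R | F (w k t)].
  move=> cF; split.
    apply: (measurable_preimage (measurable_path_coord k t)).
    rewrite -(setCK F); apply: measurableC; apply: open_measurable.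
    exact: closed_openC.
  exists [set y : U | F (y (k, t))] => //.
  apply: (@preimage_closed U R (fun y => y (k, t)) F) => // y _; exact: coord_continuous.
have GW : <<s G >> W.
  apply: smallest_sub mW; first exact: smallest_sigma_algebra.
  move=> _ [k [t [A [mA ->]]]].
  have : <<s @RGenOpens.G R >> A.
    have : (@RGenOpens.G R).-sigma.-measurable A by rewrite -RGenOpens.measurableE.
    exact.
  apply: (@smallest_sub _ _ _ [set A | <<s G >> [set w : wpath R | A (w k t)]]).
    split => /=.
    - exact: (@measurable0 _ (g_sigma_algebraType G)).
    - move=> B hB.
      rewrite (_ : [set w | _] = ~` [set w : wpath R | B (w k t)]); last first.
        by apply/seteqP; split=> w // -[].
      exact: (@measurableC _ (g_sigma_algebraType G)).
    - move=> B hB.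
      have := @bigcupT_measurable _ (g_sigma_algebraType G)
        (fun n => [set w : wpath R | B n (w k t)]) hB.
      exact.
  move=> _ [a [b ->]]; apply: sub_sigma_algebra; exists k, t, `]a, b[%classic.
  by split => //; exact: interval_open.
have [|||||||F [[mF [F' cF' FE]] FW muF]] := @inner_approx_sigma _ (Omega R) R mu
  C _ _ _ _ _ G _ _ W GW x x0.
- by move=> S [].
- by split => //; exists set0; [exact: closed0|].
- by split => //; exists setT; [exact: closedT|].
- move=> A B [mA [FA cA AE]] [mB [FB cB BE]]; split; first exact: measurableU.
  by exists (FA `|` FB); [exact: closedU|rewrite AE BE].
- move=> A hA; split; first by apply: bigcapT_measurable => i; have [] := hA i.
  have /choice[F hF] i : exists F : set U, closed F /\ A i = path_coord @^-1` F.
    by have [_ [F cF FE]] := hA i; exists F.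
  exists (\bigcap_i F i); first by apply: closed_bigI => i _; have [] := hF i.
  by rewrite preimage_bigcap; apply: eq_bigcapr => i _; have [] := hF i.
- move=> _ [k [t [V [oV ->]]]]; 
  apply: (measurable_preimage (measurable_path_coord k t)).
  exact: open_measurable.
- move=> _ [k [t [V [oV ->]]]]; split; last first.
    apply: inner_approx_refl; apply: (Ccoord k t (~` V)); exact: open_closedC.
  have -> : [set w : wpath R | V (w k t)] = \bigcup_n
      [set w : wpath R | forall y, ~ V y -> n.+1%:R^-1 <= `|w k t - y|].
    have := open_bigcup_far oV => OE; apply/seteqP; split=> w /=.
      by rewrite {1}OE => -[n _ hn]; exists n.
    by rewrite {2}OE => -[n _ hn]; exists n.
  have CC n : C [set w : wpath R | forall y, ~ V y -> n.+1%:R^-1 <= `|w k t - y|].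
    by apply: (Ccoord k t [set z | forall y, ~ V y -> n.+1%:R^-1 <= `|z - y|]);
       exact: closed_far.
  apply: inner_approx_bigcup.
  + by move=> S [].
  + by split => //; exists set0; [exact: closed0|].
  + move=> A B [mA [FA cA AE]] [mB [FB cB BE]]; split; first exact: measurableU.
    by exists (FA `|` FB); [exact: closedU|rewrite AE BE].
  + by move=> n; have [] := CC n.
  + by move=> n; apply: inner_approx_refl.
- by exists F'; rewrite -FE.
Qed.

(** An Arzela-Ascoli condition at accuracy 1 / n.+1. The time window is open so that rational times
    decide it for continuous paths. *)
Let modulus_bound n r (x : nat * R -> R) (k : nat) :=
  (forall t, `|t| < n.+1%:R -> `|x (k, t)| <= r%:R) /\
  (forall s t, `|s| < n.+1%:R -> `|t| < n.+1%:R -> `|s - t| < r.+1%:R^-1 ->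
     `|x (k, s) - x (k, t)| <= n.+1%:R^-1).

Let F n r : set U := [set x | forall k, (k <= n)%N -> modulus_bound n r x k].

Let F_closed n r : closed (F n r).
Proof.
(* The intersection over a subset of [unit] encodes the implication from closeness of s and t. *)
rewrite (_ : F n r = \bigcap_(k in [set k | (k <= n)%N])
  (\bigcap_(t in [set t | `|t| < n.+1%:R]) [set x : U | `|x (k, t)| <= r%:R] `&`
   \bigcap_(s in [set s | `|s| < n.+1%:R]) \bigcap_(t in [set t | `|t| < n.+1%:R])
    \bigcap_(_ in [set _ : unit | `|s - t| < r.+1%:R^-1])
     [set x : U | `|x (k, s) - x (k, t)| <= n.+1%:R^-1])); last first.
  apply/seteqP; split=> x h k kn; have [h1 h2] := h k kn; split.
  - by move=> t tn; exact: h1.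
  - by move=> s sn t tn i st; exact: h2.
  - by move=> t tn; exact: h1.
  - by move=> s t sn tn st; exact: (h2 s sn t tn tt st).
apply: closed_bigI => k _; apply: closedI; apply: closed_bigI => s _.
  apply: (@preimage_closed U R (fun x => `|x (k, s)|) [set z | z <= _]).
    by move=> x _; apply: (@cvg_norm _ _ _ (nbhs x)); exact: coord_continuous.
  exact: closed_le.
apply: closed_bigI => t _; apply: closed_bigI => _ _.
apply: (@preimage_closed U R (fun x => `|x (k, s) - x (k, t)|) [set z | z <= _]).
  move=> x _; apply: (@cvg_norm _ _ _ (nbhs x)).
  by apply: (@cvgB _ _ _ (nbhs x)); exact: coord_continuous.
exact: closed_le.
Qed.

Let open_norm_lt (b : R) : open [set t : R | `|t| < b].
Proof.
apply: (@open_comp _ _ (fun t : R => `|t|) [set z | z < b]); last exact: open_lt.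
by move=> t _; apply: cvg_norm; exact: cvg_id.
Qed.

(** By path continuity rational times suffice; the two times of the oscillation bound are freed one
    after the other. *)
Let measurable_F n r : measurable (path_coord @^-1` F n r).
Proof.
pose N : R := n.+1%:R.
pose M k (p : rat) := [set w : Omega R | `|ratr p| < N -> `|w k (ratr p)| <= r%:R].
pose M' k (p q : rat) := [set w : Omega R | `|ratr p| < N -> `|ratr q| < N ->
   `|ratr p - ratr q : R| < r.+1%:R^-1 -> `|w k (ratr p) - w k (ratr q)| <= n.+1%:R^-1].
have -> : path_coord @^-1` F n r = \bigcap_(k in [set k | (k <= n)%N])
   (\bigcap_p M k p `&` \bigcap_p \bigcap_q M' k p q).
  apply/seteqP; split=> w h k kn; have [h1 h2] := h k kn; split.
  - by move=> p _ hp; exact: h1.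
  - by move=> p _ q _ hp hq hpq; exact: h2.
  - apply: (@continuous_rat_le _ (fun t => `|w k t|)).
    + by move=> t; apply: cvg_norm; exact: wpath_continuous.
    + exact: open_norm_lt.
    + by move=> q hq; exact: (h1 q Logic.I hq).
  - move=> s t; move: s t.
    have cont s : continuous (fun t => `|w k s - w k t|).
      move=> t; apply: cvg_norm; apply: cvgB; first exact: cvg_cst.
      exact: wpath_continuous.
    have opn (s : R) : open [set t | `|t| < N /\ `|s - t| < r.+1%:R^-1].
      apply: (@openI _ [set t | `|t| < N] [set t | `|s - t| < r.+1%:R^-1]).
        exact: open_norm_lt.
      apply: (@open_comp _ _ (fun t : R => s - t) [set z | `|z| < _]).
        by move=> t _; apply: cvgB; [exact: cvg_cst|exact: cvg_id].
      exact: open_norm_lt.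
    have h3 (p : rat) t : `|ratr p| < N -> `|t| < N -> `|ratr p - t| < r.+1%:R^-1 ->
        `|w k (ratr p) - w k t| <= n.+1%:R^-1.
      move=> hp ht hpt.
      apply: (@continuous_rat_le _ _ _ _ (cont (ratr p)) (opn (ratr p))) => //.
      by move=> q [hq hpq]; exact: (h2 p Logic.I q Logic.I).
    move=> s t hs ht hst; rewrite distrC.
    apply: (@continuous_rat_le _ _ _ _ (cont t) (opn t)); last first.
      by split => //; rewrite distrC.
    by move=> q [hq hpq]; rewrite distrC; apply: h3 => //; rewrite distrC.
apply: bigcap_measurable; first by exists 0%N.
have mc k t := @measurable_path_coord k t.
have mimp (Q : Prop) (A : set (Omega R)) : measurable A ->
    measurable [set w | Q -> A w].
  move=> mA; have [q|nq] := pselect Q.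
    by rewrite (_ : [set w | Q -> A w] = A)//; apply/seteqP; split=> w //=; apply.
  by rewrite (_ : [set w | Q -> A w] = setT)//; apply/seteqP; split=> // w _ /nq.
move=> k _; apply: measurableI.
  apply: bigcapT_measurable_rat => p; apply: mimp.
  by apply: (@measurable_set_ler _ _ _ _ (cst _)) => //; exact: measurableT_comp.
apply: bigcapT_measurable_rat => p; apply: bigcapT_measurable_rat => q.
do 3 apply: (mimp).
apply: (@measurable_set_ler _ _ _ _ (cst _)) => //; apply: measurableT_comp => //.
exact: measurable_funB.
Qed.

Let modulus_bound_nd n r r' x k : (r <= r')%N ->
  modulus_bound n r x k -> modulus_bound n r' x k.
Proof.
move=> rr [h1 h2]; split=> [t tn|s t sn tn st].
  by apply: le_trans (h1 t tn) _; rewrite ler_nat.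
apply: h2 => //; apply: lt_le_trans st _.
by rewrite lef_pV2 ?posrE ?ltr0n// ler_nat ltnS.
Qed.

Let F_nd n r r' : (r <= r')%N -> F n r `<=` F n r'.
Proof. by move=> rr x h k kn; exact: modulus_bound_nd rr (h k kn). Qed.

(** Uniform continuity and boundedness on a compact window settle each mode; the finitely many modes
    k <= n are combined by a maximum. *)
Let F_exhaust n (w : wpath R) : exists r, F n r (path_coord w).
Proof.
suff H K : exists r, forall k, (k < K)%N -> modulus_bound n r (path_coord w) k.
  by have [r hr] := H n.+1; exists r => k kn; exact: hr.
elim: K => [|K [r hr]]; first by exists 0%N.
have cw : continuous (w K) by exact: wpath_continuous.
have [s hs] : exists s, modulus_bound n s (path_coord w) K.
  have n0 : 0 < n.+1%:R^-1 :> R by [].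
  have [s hs] := @heine R (w K) (- n.+1%:R) n.+1%:R _ cw n0.
  have [b hb] : exists b : nat, forall t, `|t| < n.+1%:R -> `|w K t| <= b%:R.
    have := @continuous_compact _ _ (w K) `[- n.+1%:R, n.+1%:R]%classic
      (continuous_subspaceT cw) (@segment_compact _ _ _).
    move=> /compact_bounded [M [Mr hM]].
    exists (Num.trunc (M + 1)).+1 => t tn.
    apply: (@le_trans _ _ (M + 1)); last by rewrite ltW// truncnS_gt.
    apply: (hM (M + 1)); first by rewrite ltrDl.
    exists t => //=; rewrite in_itv /= -ler_norml; exact: ltW.
  exists (maxn s b); split=> [t tn|t t' tn tn' tt'].
    by apply: le_trans (hb t tn) _; rewrite ler_nat leq_maxr.
  apply: hs; first by rewrite -ler_norml ltW.
  apply: lt_le_trans tt' _.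
  by rewrite lef_pV2 ?posrE ?ltr0n// ler_nat ltnS leq_maxl.
exists (maxn r s) => k; rewrite ltnS leq_eqVlt => /orP[/eqP ->|kK].
  exact: modulus_bound_nd (leq_maxr _ _) hs.
exact: modulus_bound_nd (leq_maxl _ _) (hr k kK).
Qed.

Let Q (rho : nat -> nat) : set U :=
  [set x | (forall k, x (k, 0) = 0) /\ forall n, F n (rho n) x].

Let Q_compact rho : compact (Q rho).
Proof.
(* The first accuracy level whose modes and time window include the coordinate p; its bound confines
   that coordinate to a segment. *)
pose ix (p : nat * R) := maxn p.1 (Num.trunc `|p.2|).
have ix1 (p : nat * R) : (p.1 <= ix p)%N by rewrite leq_maxl.
have ix2 (p : nat * R) : `|p.2| < (ix p).+1%:R.
  by apply: lt_le_trans (truncnS_gt _) _; rewrite ler_nat ltnS leq_maxr.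
rewrite (_ : Q rho = [set x : U |
    forall p, `[- (rho (ix p))%:R, (rho (ix p))%:R]%classic (x p)] `&`
    (\bigcap_k [set x : U | x (k, 0) = 0] `&` \bigcap_n F n (rho n))); last first.
  apply/seteqP; split=> x; last first.
    by move=> [_ [h1 h2]]; split=> [k|n]; [exact: h1|exact: h2].
  move=> [h1 h2]; split; last by split=> [k _|n _]; [exact: h1|exact: h2].
  move=> [k t] /=; rewrite in_itv /= -ler_norml.
  by have [+ _] := h2 _ k (ix1 (k, t)); apply; exact: (ix2 (k, t)).
apply: compact_closedI.
  apply: (@tychonoff (nat * R)%type (fun=> R)
    (fun p => `[- (rho (ix p))%:R, (rho (ix p))%:R]%classic)) => p.
  exact: segment_compact.
apply: closedI; apply: closed_bigI => n _; last exact: F_closed.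
apply: (@preimage_closed U R (fun x => x (n, 0)) [set z | z = 0]).
  by move=> x _; exact: coord_continuous.
exact: closed_eq.
Qed.

(** The modulus conditions make every point of [Q rho] continuous in time, and the vanishing at 0 is
    built into [Q], so the point is itself a driving path. *)
Let Q_range rho : Q rho `<=` range path_coord.
Proof.
move=> x [x0 hx].
have cx k : continuous (fun t => x (k, t)).
  move=> t; apply/cvgrPdist_le => eps eps0.
  have [m _ /(_ m (leqnn _)) /= meps] := near_infty_natSinv_lt (PosNum eps0).
  (* Level n is accurate to 1 / m.+1, controls mode k and has t in its window. *)
  pose n := maxn (maxn m k) (Num.trunc `|t|).
  have tn : `|t| < n.+1%:R.
    by apply: lt_le_trans (truncnS_gt _) _; rewrite ler_nat ltnS leq_maxr.
  have kn : (k <= n)%N by rewrite leq_max leq_maxr.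
  have [_ h] := hx n k kn.
  have : \forall s \near t, `|s| < n.+1%:R.
    by apply: open_nbhs_nbhs; split => //; exact: open_norm_lt.
  have r0 : 0 < (rho n).+1%:R^-1 :> R by [].
  have : \forall s \near t, `|t - s| < (rho n).+1%:R^-1.
    by apply/nbhs_ballP; exists (rho n).+1%:R^-1 => //= s; rewrite -ball_normE.
  apply: filterS2 => s ts sn; apply: le_trans (h t s tn sn ts) _.
  apply: le_trans (ltW meps).
  by rewrite lef_pV2 ?posrE ?ltr0n// ler_nat ltnS leq_max leq_max leqnn.
exists (WPath cx x0) => //.
by apply/funext => -[k t].
Qed.

Lemma path_tight (mu : {finite_measure set (Omega R) -> \bar R}) :
  tight path_coord mu.
Proof.
move=> x x0.
have mC n r : measurable (~` (path_coord @^-1` F n r)).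
  by apply: measurableC; exact: measurable_F.
have /choice[rho hrho] n : exists r,
    (mu (~` (path_coord @^-1` F n r)) <= (x / (2 ^ n.+1)%:R)%:E)%E.
  have xn : 0 < x / (2 ^ n.+1)%:R by rewrite divr_gt0// ltr0n expn_gt0.
  apply: (measure_nonincreasing_small xn) => //.
    by move=> r r' rr; apply/subsetPset/subsetC => w; exact: F_nd.
  rewrite (_ : \bigcap_i _ = set0) ?measure0// -subset0 => w hw.
  by have [r hr] := F_exhaust n w; exact: (hw r Logic.I).
have QE : path_coord @^-1` Q rho = \bigcap_n (path_coord @^-1` F n (rho n)).
  apply/seteqP; split=> w; first by move=> [_ h] n _; exact: h.
  move=> h; split=> [k|n]; first exact: wpath_at0.
  exact: (h n Logic.I).
exists (Q rho); split => //; rewrite QE.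
  by apply: bigcapT_measurable => n; exact: measurable_F.
by rewrite setC_bigcap; apply: measure_bigcup_small => //; exact: ltW.
Qed.

End PathSpace.

(** * Jordan decomposition of invariant measures *)

Section FiniteProduct.
Context d1 d2 (T1 : measurableType d1) (T2 : measurableType d2) (R : realType).
Variables (m1 : {finite_measure set T1 -> \bar R})
  (m2 : {finite_measure set T2 -> \bar R}).

(* A copy of the product measure, because the library declares it finite only
   for (sub)probability measures. *)
Definition finite_product : set (T1 * T2) -> \bar R := (m1 \x m2)%E.

HB.instance Definition _ := Measure.on finite_product.

Let fin_num_finite_product : fin_num_fun finite_product.
Proof.
move=> A mA; rewrite ge0_fin_numE//.
apply: (@le_lt_trans _ _ (finite_product setT)).
  by rewrite le_measure// inE.
rewrite -setXTT [ltLHS]product_measure1E// ltey_eq fin_numM//; exact: fin_num_measure.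
Qed.

HB.instance Definition _ :=
  @Measure_isFinite.Build _ _ _ finite_product fin_num_finite_product.

End FiniteProduct.

(** The identity mu - nu = m1 - m2 is stated additively, which avoids subtraction of extended
    reals. *)
Lemma hahn_jordan_finite_measures d (T : measurableType d) (R : realType)
    (mu nu : {finite_measure set T -> \bar R}) :
  exists (m1 m2 : {finite_measure set T -> \bar R}) (A : set T),
    [/\ measurable A, m1 (~` A) = 0%E, m2 A = 0%E &
        forall B, measurable B -> (mu B + m2 B = nu B + m1 B)%E].
Proof.
pose c : {charge set T -> \bar R} :=
  cadd (charge_of_finite_measure mu) (copp (charge_of_finite_measure nu)).
have [A [N hAN]] := Hahn_decomposition c.
have [[mA _] [mN _] AN AN0] := hAN.
exists (jordan_pos hAN), (jordan_neg hAN), A; split => //.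
- rewrite -[LHS]/(jordan_pos hAN (~` A)) jordan_posE cjordan_posE.
  rewrite /crestr0 mem_set; last exact: measurableC.
  by rewrite /crestr setICl charge0.
- rewrite -[LHS]/(jordan_neg hAN A) jordan_negE cjordan_negE.
  rewrite /crestr0 mem_set// /crestr AN0 charge0.
  by rewrite oppe0.
- move=> B mB.
  have : (mu B - nu B = jordan_pos hAN B - jordan_neg hAN B)%E.
    by rewrite -[LHS]/(c B) (jordan_decomp hAN mB) /cadd /= cscaleN1.
  have := fin_num_measure mu _ mB; have := fin_num_measure nu _ mB.
  have := fin_num_measure (jordan_pos hAN) _ mB.
  have := fin_num_measure (jordan_neg hAN) _ mB.
  rewrite /=; move: (mu B) (nu B) (jordan_pos hAN B) (jordan_neg hAN B).
  move=> [a| |] [b| |] [p| |] [n| |] //= _ _ _ _ [h].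
  by rewrite -!EFinD; congr EFin; lra.
Qed.

Section Invariance.
Context d1 d2 (O : measurableType d1) (T : measurableType d2) (R : realType).
Variable P : probability O R.

(** The product form allows slicing either at a fixed noise or at a fixed starting point. *)
Definition invariant_under (Phi : O * T -> T)
    (m : {finite_measure set T -> \bar R}) :=
  forall B, measurable B -> finite_product P m (Phi @^-1` B) = m B.

(* With J m the image of P \x m under Phi, J m1 - m1 = J m2 - m2; on A the left
   side is nonpositive and the right side nonnegative, on its complement the
   other way round. *)
Lemma invariant_jordan (Phi : O * T -> T)
    (mu nu m1 m2 : {finite_measure set T -> \bar R}) (A : set T) :
  measurable_fun setT Phi ->
  measurable A -> m1 (~` A) = 0%E -> m2 A = 0%E ->
  (forall B, measurable B -> (mu B + m2 B = nu B + m1 B)%E) ->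
  invariant_under Phi mu -> invariant_under Phi nu ->
  invariant_under Phi m1 /\ invariant_under Phi m2.
Proof.
move=> mPhi mA m1A m2A hB imu inu.
pose J (m : {finite_measure set T -> \bar R}) B := finite_product P m (Phi @^-1` B).
have mpre B : measurable B -> measurable (Phi @^-1` B).
  by move=> mB; exact: measurable_preimage.
have Jlin B : measurable B -> (J mu B + J m2 B = J nu B + J m1 B)%E.
  move=> mB; rewrite /J /finite_product /product_measure1 -!ge0_integralD//;
    try (by move=> w _ /=); try (by apply: measurable_fun_xsection; exact: mpre).
  apply: eq_integral => w _ /=; apply: hB.
  by apply: measurable_xsection; exact: mpre.
have Jfin m B : measurable B -> J m B \is a fin_num.
  by move=> mB; apply: fin_num_measure; exact: mpre.
have JT m : J m setT = m setT.
  rewrite /J preimage_setT -setXTT [LHS]product_measure1E//.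
  by rewrite [X in (X * _)%E]probability_setT mul1e.
have Jsplit (m : {finite_measure set T -> \bar R}) B : measurable B ->
    J m B = (J m (B `&` A) + J m (B `&` ~` A))%E.
  move=> mB; rewrite /J -measureU//=.
  - by rewrite -preimage_setU -setIUr setUv setIT.
  - by apply: mpre; exact: measurableI.
  - by apply: mpre; apply: measurableI => //; exact: measurableC.
  - by rewrite -preimage_setI setIACA setICr setI0 preimage_set0.
have msplit (m : {finite_measure set T -> \bar R}) B : measurable B ->
    m B = (m (B `&` A) + m (B `&` ~` A))%E.
  move=> mB; rewrite -measureU//=.
  - by rewrite -setIUr setUv setIT.
  - by apply: measurableI => //; exact: measurableC.
  - by apply: measurableI => //; exact: measurableC.
  - by rewrite setIACA setICr setI0.
have Jle m B C : measurable B -> measurable C -> B `<=` C -> (J m B <= J m C)%E.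
  move=> mB mC BC; rewrite le_measure// ?inE//; try exact: mpre.
  exact: preimage_subset.
have J0 m B : (0 <= J m B)%E by [].
have Jdiff B : measurable B -> (m1 B + J m2 B = m2 B + J m1 B)%E.
  move=> mB; have := hB _ mB; have := Jlin _ mB.
  rewrite (_ : J mu B = mu B); last exact: imu.
  rewrite (_ : J nu B = nu B); last exact: inu.
  rewrite -(fineK (Jfin m1 _ mB)) -(fineK (Jfin m2 _ mB)).
  rewrite -(fineK (fin_num_measure mu _ mB)) -(fineK (fin_num_measure nu _ mB)).
  rewrite -(fineK (fin_num_measure m1 _ mB)) -(fineK (fin_num_measure m2 _ mB)).
  by rewrite -!EFinD => -[h1] [h2]; congr EFin; lra.
have mCA : measurable (~` A) by exact: measurableC.
have m1T : m1 A = m1 setT by rewrite (msplit m1 setT)// !setTI m1A adde0.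
have m2T : m2 (~` A) = m2 setT by rewrite (msplit m2 setT)// !setTI m2A add0e.
have J1A : (J m1 A <= m1 A)%E by rewrite m1T -JT Jle.
have J2A : (J m2 (~` A) <= m2 (~` A))%E by rewrite m2T -JT Jle.
(* On A the identity [Jdiff] reads m1 A + J m2 A = J m1 A, and J m1 A <= m1 A because J preserves
   total mass. *)
have [J2A0 J1A1] : J m2 A = 0%E /\ J m1 A = m1 A.
  have := Jdiff _ mA; rewrite m2A add0e; have := J0 m2 A; move: J1A.
  have := Jfin m1 _ mA; have := Jfin m2 _ mA; have := fin_num_measure m1 _ mA.
  move: (J m1 A) (J m2 A) (m1 A) => [a| |] [b| |] [p| |] //= _ _ _.
  by rewrite !lee_fin => h1 h2 [h3]; split; congr EFin; lra.
have [J1C0 J2C] : J m1 (~` A) = 0%E /\ J m2 (~` A) = m2 (~` A).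
  have := Jdiff _ mCA; rewrite m1A add0e; have := J0 m1 (~` A); move: J2A.
  have := Jfin m1 _ mCA; have := Jfin m2 _ mCA; have := fin_num_measure m2 _ mCA.
  move: (J m1 (~` A)) (J m2 (~` A)) (m2 (~` A)) => [a| |] [b| |] [p| |] //= _ _ _.
  by rewrite !lee_fin => h1 h2 [h3]; split; congr EFin; lra.
have sub0 (f : set T -> \bar R) B C : (forall B, (0 <= f B)%E) ->
    (f B <= f C)%E -> f C = 0%E -> f B = 0%E.
  by move=> f0 fBC fC; apply/eqP; rewrite eq_le f0 andbT -fC.
have mle (m : {finite_measure set T -> \bar R}) B C : measurable B ->
    measurable C -> B `<=` C -> (m B <= m C)%E.
  exact: le_finite_measure.
(* On the side of A where m1 vanishes J m1 vanishes too; on the other side m2 and J m2 vanish, and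
   [Jdiff] leaves J m1 = m1. The same holds with the roles exchanged. *)
split=> B mB; rewrite -/(J _ B) Jsplit// [RHS]msplit//.
- have mBA : measurable (B `&` A) by exact: measurableI.
  have mBC : measurable (B `&` ~` A) by exact: measurableI.
  have -> : J m1 (B `&` ~` A) = 0%E by apply: sub0 (Jle m1 _ _ _ _ _) J1C0.
  have -> : m1 (B `&` ~` A) = 0%E by apply: sub0 (mle m1 _ _ _ _ _) m1A.
  have := Jdiff _ mBA.
  have -> : J m2 (B `&` A) = 0%E by apply: sub0 (Jle m2 _ _ _ _ _) J2A0.
  have -> : m2 (B `&` A) = 0%E by apply: sub0 (mle m2 _ _ _ _ _) m2A.
  by rewrite !adde0 add0e.
- have mBA : measurable (B `&` A) by exact: measurableI.
  have mBC : measurable (B `&` ~` A) by exact: measurableI.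
  have -> : J m2 (B `&` A) = 0%E by apply: sub0 (Jle m2 _ _ _ _ _) J2A0.
  have -> : m2 (B `&` A) = 0%E by apply: sub0 (mle m2 _ _ _ _ _) m2A.
  have := Jdiff _ mBC.
  have -> : J m1 (B `&` ~` A) = 0%E by apply: sub0 (Jle m1 _ _ _ _ _) J1C0.
  have -> : m1 (B `&` ~` A) = 0%E by apply: sub0 (mle m1 _ _ _ _ _) m1A.
  by rewrite !add0e adde0.
Qed.

End Invariance.

(** * Conditional laws of codes *)

Lemma ge0_integral_eq0 d (T : measurableType d) (R : realType)
    (mu : {measure set T -> \bar R}) (f : T -> \bar R) :
  measurable_fun setT f -> (forall x, (0 <= f x)%E) ->
  (\int[mu]_x f x = 0)%E <-> \forall x \ae mu, f x = 0%E.
Proof.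
move=> mf f0; have -> : (\int[mu]_x f x = \int[mu]_x `|f x|)%E.
  by apply: eq_integral => x _; rewrite gee0_abs.
rewrite ae_eq_integral_abs//; split; apply: filterS => x; first exact.
by move=> ->.
Qed.

Lemma trivIset_preimage (T U : Type) (f : T -> U) (G : nat -> set U) :
  trivIset setT G -> trivIset setT (fun k => f @^-1` G k).
Proof.
move=> /trivIsetP tG; apply/trivIsetP => i j iT jT ij.
by rewrite -preimage_setI tG// preimage_set0.
Qed.

Lemma measurable_fun_sub_sigma (R : realType) d (U : measurableType d)
    (F : set (set (wpath R))) (f : wpath R -> U) :
  F `<=` (measurable : set (set (Omega R))) ->
  measurable_fun [set: g_sigma_algebraType F] f ->
  measurable_fun [set: Omega R] f.
Proof.
move=> FO mf _ B mB.
have : <<s F >> ([set: g_sigma_algebraType F] `&` f @^-1` B) := mf measurableT B mB.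
by apply: smallest_sub => //; exact: sigma_algebra_measurable.
Qed.

(** Finite conjunctions of true bits: a generating family stable under intersection, as Dynkin's
    argument requires. *)
Definition bit_cylinders : set (set (nat -> bool)) :=
  [set H | exists s : seq nat, H = [set y : nat -> bool | all y s]].

Lemma bits_cylindersE : (@measurable _ bits) = <<s bit_cylinders >>.
Proof.
apply/seteqP; split.
  apply: smallest_sub; first exact: smallest_sigma_algebra.
  move=> _ [m ->]; apply: sub_sigma_algebra; exists [:: m].
  by apply/seteqP; split=> y /=; rewrite andbT.
apply: smallest_sub; first exact: sigma_algebra_measurable.
move=> _ [s ->]; elim: s => [|m s IH].
  by rewrite (_ : [set _ | _] = setT); [exact: measurableT|apply/seteqP; split].
rewrite (_ : [set _ | _] =
  [set y : nat -> bool | y m] `&` [set y : nat -> bool | all y s]).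
  by apply: (@measurableI _ bits) => //; apply: sub_sigma_algebra; exists m.
by apply/seteqP; split=> y /=; [move/andP|move=> [? ?]; apply/andP].
Qed.

Section ConditionalCode.
Context (R : realType) d (T : measurableType d) (P : probability (Omega R) R).
Variable F : set (set (wpath R)).
Hypothesis FO : F `<=` (measurable : set (set (Omega R))).
Variables (c : pred nat) (E : nat -> set (wpath R)) (B : nat -> set T).
Hypotheses (FE : forall m, <<s F >> (E m)) (mB : forall m, measurable (B m)).

(* Bit m depends on the conditioning alone when c m holds, and on Y otherwise. *)
Definition mixed_code (w : wpath R) (y : T) : nat -> bool :=
  fun m => if c m then `[< E m w >] else `[< B m y >].

Definition mixed_events (Y : wpath R -> T) (m : nat) : set (Omega R) :=
  [set w | if c m then E m w else B m (Y w)].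

Let code_mixed_events Y w : bit_code (mixed_events Y) w = mixed_code w (Y w).
Proof.
by apply/funext => m; rewrite /bit_code /mixed_events /mixed_code /=; case: (c m).
Qed.

Lemma measurable_mixed_code w : measurable_fun setT (mixed_code w : T -> bits).
Proof.
rewrite (_ : mixed_code w = bit_code (fun m => if c m then [set _ | E m w] else B m)).
  apply: measurable_bit_code => m; case: (c m) => //.
  have [h|h] := pselect (E m w).
    by rewrite (_ : [set _ | _] = setT)//; apply/seteqP; split.
  by rewrite (_ : [set _ | _] = set0)//; apply/seteqP; split.
by apply/funext => y; apply/funext => m; rewrite /mixed_code /bit_code; case: (c m).
Qed.

Let mpre w (H : set bits) : measurable H -> measurable (mixed_code w @^-1` H).
Proof.
exact: measurable_preimage (measurable_mixed_code w).
Qed.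

Variables (Y : wpath R -> T) (K : wpath R -> probability T R).
Hypothesis mY : forall m, measurable (mixed_events Y m).
Hypothesis regK : regular_conditional_law P F Y K.

(** Freezing formula: given the conditioning, w is held fixed in the code and only Y is integrated
    against K w. On a finite conjunction of bits this is the defining identity of the conditional
    law; Dynkin induction gives the rest. *)
Lemma conditional_code (H : set bits) : measurable H ->
  measurable_fun [set: Omega R] (fun w => K w (mixed_code w @^-1` H)) /\
  P (bit_code (mixed_events Y) @^-1` H) = (\int[P]_w K w (mixed_code w @^-1` H))%E.
Proof.
have mcode (G : set bits) : measurable G ->
    measurable (bit_code (mixed_events Y) @^-1` G).
  exact: measurable_bit_code_preimage.
have Kle w (G : set bits) : measurable G -> (K w (mixed_code w @^-1` G) <= 1)%E.
  by move=> mG; apply: probability_le1; exact: mpre.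
have KC w (G : set bits) : measurable G ->
    (K w (mixed_code w @^-1` (~` G)) = 1 - K w (mixed_code w @^-1` G))%E.
  by move=> mG; rewrite preimage_setC probability_setC//; exact: mpre.
move=> mH; have := mH; rewrite {1}bits_cylindersE.
apply: (@dynkin_induction _ bits bit_cylinders (fun H =>
  measurable_fun [set: Omega R] (fun w => K w (mixed_code w @^-1` H)) /\
  P (bit_code (mixed_events Y) @^-1` H) = (\int[P]_w K w (mixed_code w @^-1` H))%E)).
- exact: bits_cylindersE.
- move=> _ _ [s ->] [s' ->]; exists (s ++ s').
  by apply/seteqP; split=> y /=; rewrite all_cat => /andP.
- split.
    rewrite (_ : (fun w => _) = cst 1%E); first exact: measurable_cst.
    by apply/funext => w; rewrite preimage_setT probability_setT.
  rewrite preimage_setT probability_setT.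
  rewrite (eq_integral (cst 1%E)); last first.
    by move=> w _; rewrite preimage_setT probability_setT.
  by rewrite integral_cst// mul1e; apply/esym; exact: probability_setT.
- move=> _ [s ->].
  pose Es := [set w : wpath R | forall m, m \in s -> c m -> E m w].
  pose Bs := [set y : T | forall m, m \in s -> ~~ c m -> B m y].
  have FEs : <<s F >> Es.
    rewrite (_ : Es = \bigcap_(m in [set m | (m \in s) && c m]) E m); last first.
      apply/seteqP; split=> w h m; first by move=> /andP[]; exact: h.
      by move=> ms cm; apply: h; rewrite /= ms.
    have := @bigcap_measurableType _ (g_sigma_algebraType F) E
      [set m | (m \in s) && c m]; apply.
    by move=> m _; exact: FE.
  have mBs : measurable Bs.
    rewrite (_ : Bs = \bigcap_(m in [set m | (m \in s) && ~~ c m]) B m); last first.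
      apply/seteqP; split=> w h m; first by move=> /andP[]; exact: h.
      by move=> ms cm; apply: h; rewrite /= ms.
    exact: bigcap_measurableType.
  have mEs : measurable (Es : set (Omega R)).
    by move: FEs; apply: smallest_sub => //; exact: sigma_algebra_measurable.
  have [mK hK] := regK mBs.
  have mK' := measurable_fun_sub_sigma FO mK.
  (* The conditioning bits are constant in y: they either all hold, leaving [Bs], or make the
     section empty. *)
  have KE w : K w (mixed_code w @^-1` [set y : nat -> bool | all y s]) =
      ((fun w => K w Bs) \_ Es) w.
    rewrite patchE; case: ifPn => [/set_mem Ew|/negP nEw].
      congr (K w _); apply/seteqP; split=> y /=.
        move=> /allP h m ms cm; have := h m ms.
        by rewrite /mixed_code (negbTE cm) => /asboolP.
      move=> h; apply/allP => m ms; rewrite /mixed_code.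
      by case: ifPn => cm; apply/asboolP; [exact: Ew|exact: h].
    rewrite (_ : _ @^-1` _ = set0) ?measure0// -subset0 => y /= /allP h.
    apply: nEw; rewrite inE => m ms cm; have := h m ms.
    by rewrite /mixed_code cm => /asboolP.
  rewrite (_ : (fun w => K w _) = (fun w => K w Bs) \_ Es); last first.
    by apply/funext => w; exact: KE.
  split; first by apply/(measurable_restrictT _ mEs); exact: measurable_funS mK'.
  rewrite -integral_mkcond -hK//; congr (P _); apply/seteqP; split=> w /=.
    move=> /allP h; split=> [m ms cm|m ms cm]; have := h m ms;
      rewrite code_mixed_events /mixed_code; first by rewrite cm => /asboolP.
    by rewrite (negbTE cm) => /asboolP.
  move=> [Ew Bw]; apply/allP => m ms; rewrite code_mixed_events /mixed_code.
  by case: ifPn => cm; apply/asboolP; [exact: Ew|exact: Bw].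
- move=> G mG [mKG PG].
  have mKC : measurable_fun [set: Omega R]
      (fun w => K w (mixed_code w @^-1` (~` G))).
    rewrite (_ : (fun w => _) = fun w => (1 - K w (mixed_code w @^-1` G))%E).
      by apply: emeasurable_funB => //; exact: measurable_cst.
    by apply/funext => w; exact: KC.
  split => //.
  rewrite preimage_setC [LHS]probability_setC; last exact: mcode.
  rewrite PG.
  have : (\int[P]_w K w (mixed_code w @^-1` G) +
          \int[P]_w K w (mixed_code w @^-1` (~` G)) = 1)%E.
    rewrite -ge0_integralD//.
    rewrite (eq_integral (cst 1%E)).
      by rewrite integral_cst// mul1e; exact: probability_setT.
    move=> w _; rewrite KC// addeC subeK//.
    by rewrite fin_num_measure//; exact: mpre.
  have fin : (\int[P]_w K w (mixed_code w @^-1` G))%E \is a fin_num.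
    by rewrite -PG fin_num_measure//; exact: mcode.
  by move=> <-; rewrite addeAC subee// add0e.
- move=> G mG tG hG.
  have KU w : (K w (mixed_code w @^-1` (\bigcup_k G k)) =
      \sum_(k <oo) K w (mixed_code w @^-1` (G k)))%E.
    rewrite preimage_bigcup; apply/esym/cvg_lim => //.
    apply: measure_semi_sigma_additive.
    + by move=> k; exact: mpre.
    + exact: trivIset_preimage.
    + by apply: bigcup_measurable => k _; exact: mpre.
  split.
    rewrite (_ : (fun w => _) = fun w => (\sum_(k <oo) K w (mixed_code w @^-1` (G k)))%E).
      by apply: ge0_emeasurable_sum => // k _; have [] := hG k.
    by apply/funext => w; exact: KU.
  under eq_integral do rewrite KU.
  rewrite integral_nneseries//; last by move=> k; have [] := hG k.
  rewrite preimage_bigcup; apply/esym/cvg_lim => //.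
  under eq_fun do under eq_bigr do rewrite -(proj2 (hG _)).
  apply: measure_semi_sigma_additive.
  + by move=> k; exact: mcode.
  + exact: trivIset_preimage.
  + by apply: bigcup_measurable => k _; exact: mcode.
Qed.

End ConditionalCode.

(** By the freezing formula a code event is null iff almost all of its sections are null for K w.
    The sections do not involve Y, so equivalence of the conditional laws can be applied at each
    w. *)
Lemma mixed_code_null (R : realType) d (T : measurableType d)
    (P : probability (Omega R) R) (F : set (set (wpath R)))
    (c : pred nat) (E : nat -> set (wpath R)) (B : nat -> set T)
    (Y1 Y2 : wpath R -> T) (K1 K2 : wpath R -> probability T R) :
  F `<=` (measurable : set (set (Omega R))) ->
  (forall m, <<s F >> (E m)) -> (forall m, measurable (B m)) ->
  (forall m, measurable (mixed_events c E B Y1 m)) ->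
  (forall m, measurable (mixed_events c E B Y2 m)) ->
  regular_conditional_law P F Y1 K1 -> regular_conditional_law P F Y2 K2 ->
  (\forall w \ae P, equivalent_measures (K1 w) (K2 w)) ->
  forall H : set bits, measurable H ->
    P (bit_code (mixed_events c E B Y1) @^-1` H) = 0%E ->
    P (bit_code (mixed_events c E B Y2) @^-1` H) = 0%E.
Proof.
move=> FO FE mB mY1 mY2 r1 r2 K12 H mH.
have [m1 ->] := conditional_code FO FE mB mY1 r1 mH.
have [m2 ->] := conditional_code FO FE mB mY2 r2 mH.
rewrite !ge0_integral_eq0// => K1H.
apply: filterS2 K1H K12 => w h12 eqw; apply/eqw => //.
exact: measurable_preimage (measurable_mixed_code c E mB w) mH.
Qed.

(** * Low and high modes *)

Section Projections.
Context (R : realType) (X : completeNormedModType R).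
Variables (dot : {dot X for idfun}) (e : nat -> X) (Nstar : nat).
Hypothesis basis_e : hilbert_basis dot e.

Lemma PilDPih x : Pil dot e Nstar x + Pih dot e Nstar x = x.
Proof. by rewrite /Pih addrC subrK. Qed.

Lemma Xl_Pil x : Xl e Nstar (Pil dot e Nstar x).
Proof. by exists (fun k => dot x (e k)). Qed.

(** Beyond index [Nstar.-1], the basis expansion minus [Pil] is a finite combination of high basis
    vectors, and it converges to [Pih]. *)
Lemma Xh_Pih x : Xh e Nstar (Pih dot e Nstar x).
Proof.
have [_ _ /(_ x) cx] := basis_e.
have : (fun n => \sum_(k < n) dot x (e k) *: e k - Pil dot e Nstar x) @ \oo
    --> Pih dot e Nstar x by apply: cvgB => //; exact: cvg_cst.
move=> c B /c [n _ hn]; pose m := maxn n Nstar.-1.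
exists (\sum_(Nstar.-1 <= k < m) dot x (e k) *: e k); split.
  by exists m, (fun k => dot x (e k)).
have := hn m (leq_maxl _ _); rewrite /= /Pil.
rewrite -(big_mkord xpredT (fun k => dot x (e k) *: e k)).
rewrite -(big_mkord xpredT (fun k => dot x (e k) *: e k)).
by rewrite (big_cat_nat _ (n := Nstar.-1)) ?leq_maxr//= addrAC subrr add0r.
Qed.

Lemma dot_Pil x k : (k < Nstar.-1)%N -> dot (Pil dot e Nstar x) (e k) = dot x (e k).
Proof.
move=> kN; have [_ ee _] := basis_e.
rewrite /Pil linear_sumlz (bigD1 (Ordinal kN)) //= big1 ?addr0.
  by rewrite linearZl_LR /= ee eqxx mulr1.
move=> i ik; rewrite linearZl_LR /= ee.
rewrite (_ : (nat_of_ord i == k) = false) ?mulr0//.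
by apply/negbTE; apply: contra_neq ik => ik; exact: val_inj.
Qed.

Lemma eq_Pil x y : (forall k, (k < Nstar.-1)%N -> dot x (e k) = dot y (e k)) ->
  Pil dot e Nstar x = Pil dot e Nstar y.
Proof. by move=> h; apply: eq_bigr => k _; rewrite h. Qed.

Lemma Pil_continuous : continuous (Pil dot e Nstar).
Proof.
move=> x; apply: (@cvg_sumZ _ _ e X (nbhs x) (fun k => dot x (e k))
  (fun k y => dot y (e k)) Nstar.-1 (nbhs_filter x)) => k.
exact: dot_basis_continuous.
Qed.

End Projections.

Lemma ae_False_probability d (T : measurableType d) (R : realType)
    (P : probability T R) : ~ (\forall w \ae P, False).
Proof.
move=> [N [mN PN NT]]; have : P setT = 0%E.
  apply/eqP; rewrite eq_le measure_ge0 andbT -PN le_measure// ?inE//.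
  by move=> w _; exact: NT.
by rewrite probability_setT => /eqP; rewrite onee_eq0.
Qed.

Lemma ae_measurable_full d (T : measurableType d) (R : realType)
    (mu : {measure set T -> \bar R}) (A : set T) : measurable A ->
  (\forall w \ae mu, A w) -> mu (~` A) = 0%E.
Proof.
move=> mA [N [mN PN NT]]; apply/eqP; rewrite eq_le measure_ge0 andbT -PN.
by rewrite le_measure ?inE//; exact: measurableC.
Qed.

Lemma finite_product_ysection d1 d2 (T1 : measurableType d1)
    (T2 : measurableType d2) (R : realType)
    (m1 : {finite_measure set T1 -> \bar R})
    (m2 : {finite_measure set T2 -> \bar R}) (A : set (T1 * T2)) :
  measurable A ->
  finite_product m1 m2 A = (\int[m2]_u m1 (ysection A u))%E.
Proof.
move=> mA; rewrite /finite_product.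
rewrite (@product_measure_unique _ _ _ _ _ m1 m2 (m1 \x^ m2)%E)//.
by move=> B C mB mC; exact: product_measure2E.
Qed.

Section SeparatedSets.
Context (R : realType) (X : normedModType R).

(** Regularity gives disjoint closed sets F and F' nearly carrying m1 and m2. Disjoint closed sets
    may be at distance 0, so F' is cut down to its points at distance at least 1 / n.+1 from F,
    which exhaust it. *)
Lemma separated_closed (m1 m2 : {finite_measure set (borel X) -> \bar R})
    (A : set (borel X)) (x : R) : 0 < x -> measurable A ->
  m1 (~` A) = 0%E -> m2 A = 0%E ->
  exists (F1 F2 : set (borel X)) (r : R), [/\ measurable F1 /\ measurable F2,
    0 < r, (m1 (~` F1) <= x%:E)%E, (m2 (~` F2) <= x%:E)%E &
    forall y z : X, F1 y -> F2 z -> r <= `|y - z|].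
Proof.
move=> x0 mA m1A m2A; have x2 : 0 < x / 2 by rewrite divr_gt0.
have mCA := measurableC mA.
have [F [cF mF FA m1F]] := borel_closed_regular m1 mA x0.
have [F' [cF' mF' FA' m2F']] := borel_closed_regular m2 mCA x2.
have small (m : {finite_measure set (borel X) -> \bar R}) (B C : set (borel X)) z :
    measurable B -> measurable C -> m (~` B) = 0%E -> C `<=` B ->
    (m (B `\` C) <= z)%E -> (m (~` C) <= z)%E.
  move=> mB mC mB0 CB mBC.
  apply: (@le_trans _ _ (m (~` B `|` B `\` C))).
    apply: le_finite_measure; first exact: measurableC.
      by apply: measurableU; [exact: measurableC|exact: measurableD].
    by move=> u Cu; have [Bu|nBu] := pselect (B u); [right|left].
  apply: le_trans (measureU2 _ _ _) _; first exact: measurableC.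
    exact: measurableD.
  by have /= -> := mB0; rewrite add0e.
pose F2 n : set (borel X) :=
  F' `&` [set u : X | forall y : X, F y -> n.+1%:R^-1 <= `|u - y|].
have mF2 n : measurable (F2 n).
  apply: measurableI; first exact: mF'.
  by apply: (@closed_borel_measurable X); exact: closed_far.
have [||||n hn] := @measure_nonincreasing_small _ _ _ m2 (fun n => ~` F2 n) (x / 2) x.
- by rewrite ltr_pdivrMr// mulr_natr mulr2n ltrDl.
- by move=> n; exact: measurableC.
- move=> n n' nn; apply/subsetPset/subsetC => u [F'u hu]; split => // y Fy.
  apply: le_trans (hu y Fy).
  by rewrite lef_pV2 ?posrE ?ltr0n// ler_nat ltnS.
- apply: (@le_trans _ _ (m2 (~` (F' : set (borel X))))); last first.
    apply: (small _ (~` A)) => //; rewrite setCK; exact: m2A.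
  apply: le_finite_measure.
  + by apply: bigcapT_measurable => n; exact: measurableC.
  + exact: measurableC.
  + move=> u hu F'u; have nFu : (~` F) u by move=> /FA; exact: FA'.
    have := open_bigcup_far (closed_openC cF) => E.
    move: nFu; rewrite E => -[n _ hun]; apply: (hu n Logic.I); split => // y Fy.
    by apply: hun; exact.
- exists F, (F2 n), n.+1%:R^-1; split => //.
  + exact: (small m1 A).
  + by move=> y z Fy [_ hz]; rewrite distrC; exact: hz.
Qed.

End SeparatedSets.

(** * Asymptotic gap between singular invariant measures *)

(** The first Borel-Cantelli lemma. *)
Lemma setC_liminf_null d (T : measurableType d) (R : realType)
    (mu : {finite_measure set T -> \bar R}) (S : nat -> set T) :
  (forall m, measurable (S m)) ->
  (forall m, (mu (~` S m) <= (1 / (2 ^ m.+1)%:R)%:E)%E) ->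
  measurable (\bigcup_M \bigcap_(m in [set m | (M <= m)%N]) S m) /\
  mu (~` \bigcup_M \bigcap_(m in [set m | (M <= m)%N]) S m) = 0%E.
Proof.
move=> mS muS; split.
  by apply: bigcup_measurable => M _; apply: bigcap_measurableType.
rewrite setC_bigcup.
have := @lim_sup_set_cvg0 _ _ _ mu (fun m => ~` S m) _ _.
rewrite /lim_sup_set => H.
rewrite (_ : \bigcap_i _ = \bigcap_n \bigcup_(j >= n) ~` S j).
  apply: H => [k|]; first exact: measurableC.
  apply: (@le_lt_trans _ _ 1%:E); last by rewrite ltry.
  apply: le_trans (epsilon_trick0 xpredT ler01).
  by apply: lee_nneseries => // m _; exact: muS.
by apply: eq_bigcapr => M _; rewrite setC_bigcap.
Qed.

(** Invariance keeps the preimages of F1 and F2 nearly full at every time n, so [common_times]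
    applies. Its output has a small defect and a gap r depending on m; by Borel-Cantelli almost
    every point lies in all late [S m], and any m late for both points supplies their r. *)
Lemma asymptotic_gap d (O : measurableType d) (R : realType) (X : normedModType R)
    (P : probability O R) (Phi : nat -> O * borel X -> borel X)
    (m1 m2 : {finite_measure set (borel X) -> \bar R}) (A : set (borel X)) :
  (forall n, measurable_fun setT (Phi n)) ->
  measurable A -> m1 (~` A) = 0%E -> m2 A = 0%E ->
  (forall n, invariant_under P (Phi n) m1) ->
  (forall n, invariant_under P (Phi n) m2) ->
  exists T1 T2 : set (O * borel X), [/\ measurable T1 /\ measurable T2,
    finite_product P m1 (~` T1) = 0%E, finite_product P m2 (~` T2) = 0%E &
    forall z1 z2, T1 z1 -> T2 z2 -> exists2 r : R, 0 < r &
      forall N, exists2 n, (N <= n)%N & r <= `|(Phi n z1 : X) - Phi n z2|].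
Proof.
move=> mPhi mA m1A m2A i1 i2.
(* The divisor cancels the factor 9 lost in [common_times], leaving summable defects. *)
pose x m : R := 1 / (2 ^ m.+1)%:R / 9.
have x0 m : 0 < x m by rewrite divr_gt0// divr_gt0// ltr0n expn_gt0.
have x9 m : 9 * x m = 1 / (2 ^ m.+1)%:R by rewrite mulrC divfK.
have mpre n (B : set (borel X)) : measurable B -> measurable (Phi n @^-1` B).
  exact: measurable_preimage (mPhi n).
have H m : exists S : set (O * borel X) * set (O * borel X),
    [/\ measurable S.1 /\ measurable S.2,
      (finite_product P m1 (~` S.1) <= (9 * x m)%:E)%E,
      (finite_product P m2 (~` S.2) <= (9 * x m)%:E)%E &
      exists2 r : R, 0 < r & forall z1 z2, S.1 z1 -> S.2 z2 ->
      forall N, exists2 n, (N <= n)%N & r <= `|(Phi n z1 : X) - Phi n z2|].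
  have [F1 [F2 [r [[mF1 mF2] r0 F1x F2x hr]]]] :=
    separated_closed (x0 m) mA m1A m2A.
  have [|||||| S1 [S2 [mS S1x S2x hS]]] := @common_times _ _ _
    (finite_product P m1) (finite_product P m2)
    (fun n => Phi n @^-1` F1) (fun n => Phi n @^-1` F2) (x m).
  - exact: x0.
  - by move=> n; exact: mpre.
  - by move=> n; exact: mpre.
  - move=> n s Fs F's; have := hr _ _ Fs F's.
    by rewrite subrr normr0 leNgt r0.
  - move=> n; apply: le_trans F1x.
    by rewrite -(i1 n _ (measurableC mF1)) -preimage_setC.
  - move=> n; apply: le_trans F2x.
    by rewrite -(i2 n _ (measurableC mF2)) -preimage_setC.
  exists (S1, S2); split => //; exists r => // z1 z2 S1z S2z N.
  by have [n [Nn F1n F2n]] := hS _ _ S1z S2z N; exists n => //; exact: hr.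
move/choice : H => [S hS].
have mS1 m : measurable (S m).1 by have [[]] := hS m.
have mS2 m : measurable (S m).2 by have [[]] := hS m.
have S1x m : (finite_product P m1 (~` (S m).1) <= (1 / (2 ^ m.+1)%:R)%:E)%E.
  by rewrite -x9; have [] := hS m.
have S2x m : (finite_product P m2 (~` (S m).2) <= (1 / (2 ^ m.+1)%:R)%:E)%E.
  by rewrite -x9; have [] := hS m.
have [mT1 T10] := setC_liminf_null mS1 S1x.
have [mT2 T20] := setC_liminf_null mS2 S2x.
exists (\bigcup_M \bigcap_(m in [set m | (M <= m)%N]) (S m).1),
       (\bigcup_M \bigcap_(m in [set m | (M <= m)%N]) (S m).2); split => //.
move=> z1 z2 [M1 _ h1] [M2 _ h2].
have [_ _ _ [r r0 hr]] := hS (maxn M1 M2); exists r => //.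
by apply: hr; [apply: h1; exact: leq_maxl|apply: h2; exact: leq_maxr].
Qed.

Lemma full_sections d1 d2 (T1 : measurableType d1) (T2 : measurableType d2)
    (R : realType) (P : probability T1 R) (m : {finite_measure set T2 -> \bar R})
    (S : set (T1 * T2)) :
  measurable S -> finite_product P m (~` S) = 0%E ->
  measurable [set u | P (~` ysection S u) = 0%E] /\
  m (~` [set u | P (~` ysection S u) = 0%E]) = 0%E.
Proof.
move=> mS S0; have mCS := measurableC mS.
have mf := measurable_fun_ysection P mCS.
have Cy u : ~` ysection S u = ysection (~` S) u.
  by apply/seteqP; split=> w /=; rewrite /ysection /= !inE.
have mW : measurable [set u | P (~` ysection S u) = 0%E].
  rewrite (_ : mkset _ = (P \o ysection (~` S)) @^-1` [set 0%E]).
    exact: measurable_preimage mf _.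
  by apply/seteqP; split=> u /=; rewrite Cy.
split => //; apply: ae_measurable_full => //.
move: S0; rewrite finite_product_ysection//.
rewrite ge0_integral_eq0//; apply: filterS => u /=.
by rewrite Cy.
Qed.

(** * The flow and its low modes *)

Lemma path_ofE (R : realType) (X : normedModType R) (f : R -> X) (t : halfline R) :
  {within `[0, +oo[, continuous f} ->
  (path_of f : continuousType (halfline R) X) t = f (\val t).
Proof.
rewrite (_ : `[0, +oo[%classic = [set t : R | 0 <= t]); last first.
  by apply/seteqP; split=> s /=; rewrite in_itv /= andbT.
move=> /subspace_sigL_continuousP cf; rewrite /path_of.
case: xgetP => [g _ -> //|/(_ (mkcts cf))].
by move=> h; exfalso; apply: h => s.
Qed.

(** Evaluation at t in V is the compact-open condition for the compact set consisting of t alone. *)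
Lemma measurable_path_eval (R : realType) (X : normedModType R) (V : set X)
    (t : halfline R) : open V ->
  measurable ([set g | V ((g : continuousType (halfline R) X) t)] :
    set (borel_Cpath X)).
Proof.
move=> oV; apply: sub_sigma_algebra.
exists [set g : halfline R -> X | g @` [set t] `<=` V].
  by apply: compact_open_open => //; exact: compact_set1.
apply/seteqP; split=> g /=; first by apply; exists t.
by move=> Vg _ [_ -> <-].
Qed.

Lemma nonneg_rat_dense (R : realType) (f g : R -> R) :
  {within `[0, +oo[, continuous f} -> {within `[0, +oo[, continuous g} ->
  (forall q : rat, 0 <= ratr q :> R -> f (ratr q) = g (ratr q)) ->
  forall t, 0 <= t -> f t = g t.
Proof.
move=> cf cg fg t t0; apply/eqP/negPn/negP => fgt.
have t0' : `[0, +oo[%classic t by rewrite /= in_itv /= t0.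
have ct : f s - g s @[s --> within `[0, +oo[ (nbhs t)] --> f t - g t.
  by apply: cvgB; [move/subspace_continuousP : cf; exact|
                   move/subspace_continuousP : cg; exact].
have d0 : 0 < `|f t - g t| by rewrite normr_gt0 subr_eq0.
have /cvgrPdist_lt/(_ _ d0)/nbhs_ballP[r /= r0 hr] := ct.
(* A rational to the right of t stays in the half-line even when t = 0. *)
have /rat_in_itvoo[q /itvP qr] : t < t + r by rewrite ltrDl.
have q0 : 0 <= ratr q :> R by rewrite (le_trans t0)// qr.
have tq : ball t r (ratr q).
  by rewrite /ball /= distrC ger0_norm ?subr_ge0 ?qr// ltrBlDl qr.
have q0' : `[0, +oo[%classic (ratr q : R) by rewrite /= in_itv /= q0.
by have := hr _ tq q0'; rewrite /= fg// subrr subr0 ltxx.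
Qed.

Lemma eq_ratr_lt (R : realType) (a b : R) :
  (forall q : rat, (ratr q < a) = (ratr q < b)) -> a = b.
Proof.
move=> h; have [ab|ba|//] := ltgtP a b.
  have /rat_in_itvoo[q /itvP qab] := ab.
  by have := h q; rewrite [RHS]qab ltNge ltW// qab.
have /rat_in_itvoo[q /itvP qab] := ba.
by have := h q; rewrite [LHS]qab => /esym; rewrite ltNge ltW// qab.
Qed.

Lemma eta_events_measurable (R : realType) (sigma : nat -> R) (Nstar : nat)
    (I : set R) :
  eta_events sigma Nstar I `<=` (measurable : set (set (Omega R))).
Proof.
move=> _ [k [r [r' [A [_ _ _ mA ->]]]]].
have mf : measurable_fun setT
    (fun w : Omega R => sigma k * w k r' - sigma k * w k r).
  by apply: measurable_funB; apply: measurable_funM => //;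
     exact: measurable_path_coord.
by have := mf measurableT A mA; rewrite setTI.
Qed.

Section Flow.
Context (R : realType) (X : completeNormedModType R).
Variables (dot : {dot X for idfun}) (e : nat -> X) (Nstar : nat).
Variables (DG : set X) (G : X -> X) (sigma : nat -> R).
Variable P : probability (Omega R) R.
Variable phi : R -> R -> wpath R -> X -> X.
Hypotheses (basis_e : hilbert_basis dot e)
  (flow_phi : stochastic_flow dot e DG G sigma P phi).

Definition flow_at (t : R) : Omega R * borel X -> borel X :=
  fun z => phi 0 t z.1 z.2.

Lemma measurable_flow_at t : 0 <= t -> measurable_fun setT (flow_at t).
Proof. by move=> t0; have [h _ _] := flow_phi; exact: h. Qed.

Lemma measurable_flow_from t u : 0 <= t ->
  measurable_fun setT (fun w : Omega R => phi 0 t w u : borel X).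
Proof.
move=> t0.
exact: (measurable_fun_pair1 (u : borel X) (measurable_flow_at t0)).
Qed.

Lemma measurable_Pil :
  measurable_fun setT (Pil dot e Nstar : borel X -> borel X).
Proof.
by apply: (@continuous_borel_measurable X X); exact: Pil_continuous basis_e.
Qed.

Section LowModes.
Variable Qt : R -> X -> X -> wpath R -> probability (borel X) R.
Hypotheses (version_Qt : is_Qt dot e Nstar sigma P phi Qt)
  (Qt_lebesgue : forall t l0 h0, 0 < t -> Xl e Nstar l0 -> Xh e Nstar h0 ->
     \forall w \ae P,
       equivalent_measures (T := borel X) (Qt t l0 h0 w) (lebesgue_Xl e Nstar)).

(** Conditioning on the sure event writes the probability as the integral of Qt over the noise; Qt
    charges C for almost every noise or for almost none, according to whether C has positive
    Lebesgue measure. *)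
Lemma low_modes_lebesgue u (C : set (borel X)) : measurable C ->
  P [set w | C (Pil dot e Nstar (phi 0 1 w u))] = 0%E <->
  lebesgue_Xl e Nstar C = 0%E.
Proof.
move=> mC.
have hl := Xl_Pil dot e Nstar u.
have hh := @Xh_Pih _ _ _ _ Nstar basis_e u.
have [hm hK] := version_Qt ltr01 hl hh mC.
have FO : eta_events sigma Nstar `[0, 1] `<=` (measurable : set (set (Omega R))).
  exact: eta_events_measurable.
have mK := measurable_fun_sub_sigma FO hm.
have := hK setT (@measurableT _ (g_sigma_algebraType (eta_events sigma Nstar `[0, 1]))).
rewrite setTI PilDPih => ->.
have ae := Qt_lebesgue ltr01 hl hh.
have FF : Filter (almost_everywhere P) := ae_filter_ringOfSetsType P.
rewrite ge0_integral_eq0//; split=> h.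
  apply: contrapT => nL; apply: (@ae_False_probability _ _ _ P).
  by apply: filterS2 ae h => w ew hw; apply: nL; exact: (proj1 (ew C mC) hw).
by apply: filterS ae => w ew; exact: (proj2 (ew C mC) h).
Qed.

(** Invariance at time 1 replaces m by its image under the flow, whose low modes are equivalent to
    Lebesgue measure from every starting point. *)
Lemma invariant_low_modes (m : {finite_measure set (borel X) -> \bar R})
    (C : set (borel X)) :
  invariant_under P (flow_at 1) m -> m setT != 0%E -> measurable C ->
  m (Pil dot e Nstar @^-1` C) = 0%E <-> lebesgue_Xl e Nstar C = 0%E.
Proof.
move=> im mT mC.
have mPC : measurable (Pil dot e Nstar @^-1` C : set (borel X)).
  exact: measurable_preimage measurable_Pil mC.
rewrite -im//.
have mS : measurable (flow_at 1 @^-1` (Pil dot e Nstar @^-1` C)).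
  exact: measurable_preimage (measurable_flow_at ler01) mPC.
have mf := measurable_fun_ysection P mS.
rewrite finite_product_ysection// ge0_integral_eq0//.
have yE u : P (ysection (flow_at 1 @^-1` (Pil dot e Nstar @^-1` C)) u) = 0%E <->
    lebesgue_Xl e Nstar C = 0%E.
  rewrite -(low_modes_lebesgue u mC) (_ : ysection _ _ =
    [set w | C (Pil dot e Nstar (phi 0 1 w u))])//.
  by apply/seteqP; split=> w; rewrite /ysection /= inE.
split=> [h|L0]; last by apply: nearW => u; exact/yE.
apply: contrapT => nL; move/eqP : mT; apply.
have [N [mN mN0 hN]] := h; apply/eqP; rewrite eq_le measure_ge0 andbT -mN0.
apply: le_finite_measure => // u _; apply: hN => /= hu.
by apply: nL; exact: (proj1 (yE u) hu).
Qed.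

End LowModes.

End Flow.

(** * Two flow lines with a common noise and low-mode path *)

Section Coupling.
Context (R : realType) (X : completeNormedModType R).
Variables (dot : {dot X for idfun}) (e : nat -> X) (Nstar : nat).
Variables (DG : set X) (G : X -> X) (sigma : nat -> R).
Variable P : probability (Omega R) R.
Variable phi : R -> R -> wpath R -> X -> X.
Hypotheses (basis_e : hilbert_basis dot e)
  (flow_phi : stochastic_flow dot e DG G sigma P phi).

(** Half-spaces with rational threshold in the low coordinates, enumerated through [unpickle]; their
    code determines [Pil u] and depends on u through it alone. *)
Definition low_mode_events (m : nat) : set (borel X) :=
  if (unpickle m : option (nat * rat)) is Some (k, q) then
    [set u : X | (k < Nstar.-1)%N /\ ratr q < dot u (e k)]
  else set0.

Lemma measurable_low_mode_events m : measurable (low_mode_events m).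
Proof.
rewrite /low_mode_events; case: (unpickle m) => [[k q]|]; last exact: measurable0.
have [kN|kN] := pselect (k < Nstar.-1)%N; last first.
  by rewrite (_ : [set _ | _] = set0)//; apply/seteqP; split=> u // -[].
rewrite (_ : [set _ | _] = [set u : X | ratr q < dot u (e k)]); last first.
  by apply/seteqP; split=> u //= -[].
apply: sub_sigma_algebra; apply: (@open_comp _ _ (fun u => dot u (e k)) [set z | _ < z]).
  by move=> u _; exact: dot_basis_continuous.
exact: open_gt.
Qed.

Lemma low_mode_code_Pil u :
  bit_code low_mode_events (Pil dot e Nstar u) = bit_code low_mode_events u.
Proof.
apply/funext => m; rewrite /bit_code /low_mode_events.
case: (unpickle m) => [[k q]|] //; apply: asbool_equiv_eq; split=> -[kN];
  by rewrite /= ?dot_Pil// => h; split; rewrite ?dot_Pil.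
Qed.

Lemma low_mode_code_eq u v :
  bit_code low_mode_events u = bit_code low_mode_events v ->
  Pil dot e Nstar u = Pil dot e Nstar v.
Proof.
move=> uv; apply: eq_Pil => k kN; apply: eq_ratr_lt => q.
have := congr1 (fun y => y (pickle (k, q))) uv.
rewrite /bit_code /low_mode_events pickleK => E0; have [h1 h2] := asbool_eq_equiv E0.
apply/idP/idP => h; first by have [] := h1 (conj kN h).
by have [] := h2 (conj kN h).
Qed.

(** An event on the low-mode code is the preimage under [Pil] of a Borel set, so absolute continuity
    of the low-mode marginals is what [code_selection] asks for. *)
Lemma same_low_modes_selection
    (m1 m2 : {finite_measure set (borel X) -> \bar R}) (W1 W2 : set (borel X)) :
  (forall C : set (borel X), measurable C ->
     m1 (Pil dot e Nstar @^-1` C) = 0%E -> m2 (Pil dot e Nstar @^-1` C) = 0%E) ->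
  measurable W1 -> measurable W2 -> m1 (~` W1) = 0%E -> m2 (~` W2) = 0%E ->
  m2 setT != 0%E ->
  exists u v, [/\ W1 u, W2 v & Pil dot e Nstar u = Pil dot e Nstar v].
Proof.
move=> ac mW1 mW2 W10 W20 m20.
have [|u [v [W1u W2v uv]]] := @code_selection _ _ _ _ _ _ _ _ _ m1 m2
  low_mode_events low_mode_events W1 W2
  (borel_closed_regular m1) (hilbert_tight basis_e m1)
  (borel_closed_regular m2) (hilbert_tight basis_e m2)
  measurable_low_mode_events measurable_low_mode_events mW1 mW2 W10 W20 m20.
  move=> H mH; have mC : measurable (bit_code low_mode_events @^-1` H).
    by apply: measurable_bit_code_preimage mH; exact: measurable_low_mode_events.
  have := ac _ mC; rewrite (_ : _ @^-1` _ = bit_code low_mode_events @^-1` H)//.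
  by apply/seteqP; split=> u /=; rewrite low_mode_code_Pil.
by exists u, v; split => //; exact: low_mode_code_eq.
Qed.

(* In (b, k, q, r) the bit b selects the increment over [0, q] of the k-th noise
   (true) or the k-th coordinate of the path at time q (false); either is compared
   with r. *)
Definition noise_index (m : nat) : option (bool * nat * rat * rat) := unpickle m.

Definition is_noise_index (m : nat) : bool :=
  if noise_index m is Some (true, _, _, _) then true else false.

Definition noise_events (m : nat) : set (wpath R) :=
  if noise_index m is Some (_, k, q, r) then
    [set w | ((Nstar <= k.+1)%N /\ 0 <= ratr q :> R) /\
             ratr r < sigma k * w k (ratr q) - sigma k * w k 0]
  else set0.

(** The existential over [halfline R] expresses q >= 0 along with evaluation at time q. *)
Definition low_path_events (m : nat) : set (borel_Cpath X) :=
  if noise_index m is Some (_, k, q, r) then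
    [set g : Cpath X | exists t : halfline R,
       [/\ (k < Nstar.-1)%N, \val t = ratr q &
           ratr r < dot ((g : continuousType (halfline R) X) t) (e k)]]
  else set0.

Lemma noise_events_generated m :
  <<s eta_events sigma Nstar `[0, +oo[ >> (noise_events m).
Proof.
rewrite /noise_events; case: (noise_index m) => [[[[b k] q] r]|]; last first.
  exact: (@measurable0 _ (g_sigma_algebraType (eta_events sigma Nstar `[0, +oo[))).
have [[kN q0]|nkq] := pselect ((Nstar <= k.+1)%N /\ 0 <= ratr q :> R); last first.
  apply: (@eq_ind _ set0 <<s eta_events sigma Nstar `[0, +oo[ >>); last first.
    by apply/esym; rewrite -subset0 => w [/nkq].
  exact: (@measurable0 _ (g_sigma_algebraType (eta_events sigma Nstar `[0, +oo[))).
apply: sub_sigma_algebra; exists k, 0, (ratr q), `]ratr r, +oo[%classic; split => //.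
- by rewrite /= in_itv /= lexx.
- by rewrite /= in_itv /= q0.
- by apply/seteqP; split=> w /=; rewrite in_itv /= andbT; [case|split].
Qed.

Lemma measurable_low_path_events m : measurable (low_path_events m).
Proof.
rewrite /low_path_events; case: (noise_index m) => [[[[b k] q] r]|]; last first.
  exact: measurable0.
have [[kN [t tq]]|nkq] := pselect ((k < Nstar.-1)%N /\
    exists t : halfline R, \val t = ratr q); last first.
  rewrite (_ : [set _ | _] = set0)//; apply/seteqP; split=> g // -[t [kN tq _]].
  by apply: nkq; split => //; exists t.
rewrite (_ : [set _ | _] = [set g : Cpath X |
    [set x | ratr r < dot x (e k)] ((g : continuousType (halfline R) X) t)]).
  apply: measurable_path_eval.
  apply: (@open_comp _ _ (fun u => dot u (e k)) [set z | _ < z]).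
    by move=> u _; exact: dot_basis_continuous.
  exact: open_gt.
apply/seteqP; split=> g /=; last by move=> h; exists t.
move=> [t' [_ t'q]]; rewrite (_ : t' = t)//; apply: val_inj.
exact: etrans t'q (esym tq).
Qed.

Definition low_path (u : X) (w : wpath R) : borel_Cpath X :=
  path_of (fun t => Pil dot e Nstar (phi 0 t w u)).

Lemma low_path_continuous u w :
  {within `[0, +oo[, continuous (fun t => Pil dot e Nstar (phi 0 t w u))}.
Proof.
have [_ /(_ 0 w u) cphi _] := flow_phi.
apply: (@within_continuous_comp X R X _ (fun t => phi 0 t w u)
  (Pil dot e Nstar) _ cphi) => x _.
exact: Pil_continuous.
Qed.

Lemma low_path_eventsE u w m : low_path_events m (low_path u w) <->
  (if noise_index m is Some (_, k, q, r) then
     [/\ (k < Nstar.-1)%N, 0 <= ratr q :> R &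
         ratr r < dot (phi 0 (ratr q) w u) (e k)]
   else False).
Proof.
rewrite /low_path_events; case: (noise_index m) => [[[[b k] q] r]|]; last by split.
split.
  move=> [t [kN tq]]; rewrite path_ofE; last exact: low_path_continuous.
  rewrite tq dot_Pil// => h; split => //; rewrite -tq.
  by have /set_mem := valP t.
move=> [kN q0 h]; pose t : halfline R := exist _ (ratr q) (mem_set q0).
exists t; split => //; rewrite path_ofE; last exact: low_path_continuous.
by rewrite dot_Pil.
Qed.

Let trace_events u := mixed_events is_noise_index noise_events low_path_events
  (low_path u).

(** A path event looks at one rational time, so it reduces to measurability of the flow map at that
    time. *)
Lemma measurable_trace_events u m : measurable (trace_events u m).
Proof.
rewrite /trace_events /mixed_events; case: (is_noise_index m).
  have := noise_events_generated m.
  apply: smallest_sub; first exact: sigma_algebra_measurable.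
  exact: eta_events_measurable.
rewrite (_ : [set w | _] = [set w | if noise_index m is Some (_, k, q, r) then
     [/\ (k < Nstar.-1)%N, 0 <= ratr q :> R &
         ratr r < dot (phi 0 (ratr q) w u) (e k)]
   else False]); last first.
  by apply/seteqP; split=> w /=; rewrite low_path_eventsE.
case: (noise_index m) => [[[[b k] q] r]|]; last first.
  by rewrite (_ : [set _ | _] = set0)//; apply/seteqP; split.
have [[kN q0]|nkq] := pselect ((k < Nstar.-1)%N /\ 0 <= ratr q :> R); last first.
  rewrite (_ : [set _ | _] = set0)//; apply/seteqP; split=> w // -[? ? _].
  exact: nkq.
rewrite (_ : [set _ | _] = (fun w : Omega R => phi 0 (ratr q) w u : borel X) @^-1`
    [set x : X | ratr r < dot x (e k)]); last first.
  by apply/seteqP; split=> w //= -[].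
apply: (measurable_preimage (measurable_flow_from flow_phi u q0)).
apply: sub_sigma_algebra.
apply: (@open_comp _ _ (fun u => dot u (e k)) [set z | _ < z]).
  by move=> x _; exact: dot_basis_continuous.
exact: open_gt.
Qed.

(** Rational thresholds determine the values at rational times, and continuity extends equality to
    all t >= 0. *)
Lemma trace_code_eq u v w w' :
  bit_code (trace_events u) w = bit_code (trace_events v) w' ->
  (forall t, 0 <= t -> forall k, (Nstar <= k.+1)%N ->
     sigma k * w k t - sigma k * w k 0 = sigma k * w' k t - sigma k * w' k 0) /\
  (forall t, 0 <= t ->
     Pil dot e Nstar (phi 0 t w u) = Pil dot e Nstar (phi 0 t w' v)).
Proof.
move=> E; split.
- move=> t t0 k kN.
  have cw (x : wpath R) :
      {within `[0, +oo[, continuous (fun t => sigma k * x k t - sigma k * x k 0)}.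
    apply: continuous_subspaceT => s; apply: cvgB; last exact: cvg_cst.
    by apply: cvgM; [exact: cvg_cst|exact: wpath_continuous].
  apply: (nonneg_rat_dense (cw w) (cw w')) t0 => q q0.
  apply: eq_ratr_lt => r.
  have := congr1 (fun y => y (pickle (true, k, q, r))) E.
  rewrite /bit_code /trace_events /mixed_events /is_noise_index /noise_events.
  rewrite /noise_index pickleK => E0; have [h1 h2] := asbool_eq_equiv E0.
  apply/idP/idP => h; first by have [] := h1 (conj (conj kN q0) h).
  by have [] := h2 (conj (conj kN q0) h).
- move=> t t0; apply: eq_Pil => k kN.
  have cp x w0 : {within `[0, +oo[, continuous (fun t => dot (phi 0 t w0 x) (e k))}.
    have [_ /(_ 0 w0 x) cphi _] := flow_phi.
    apply: (@within_continuous_comp X R R _ (fun t => phi 0 t w0 x)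
      (fun y => dot y (e k)) _ cphi) => y _.
    exact: dot_basis_continuous.
  apply: (nonneg_rat_dense (cp u w) (cp v w')) t0 => q q0.
  apply: eq_ratr_lt => r.
  have := congr1 (fun y => y (pickle (false, k, q, r))) E.
  rewrite /bit_code /trace_events /mixed_events /is_noise_index.
  rewrite /noise_index pickleK => E0; have := asbool_eq_equiv E0.
  rewrite /= !low_path_eventsE /noise_index pickleK => -[h1 h2].
  apply/idP/idP => h; first by have [] := h1 (And3 kN q0 h).
  by have [] := h2 (And3 kN q0 h).
Qed.

Variable Qinf : X -> X -> wpath R -> probability (borel_Cpath X) R.
Hypotheses (version_Qinf : is_Qinf dot e Nstar sigma P phi Qinf)
  (Qinf_equiv : forall l0 h0 h0', Xl e Nstar l0 -> Xh e Nstar h0 ->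
     Xh e Nstar h0' ->
     \forall w \ae P, equivalent_measures (Qinf l0 h0 w) (Qinf l0 h0' w)).

(** With equal low modes, u and v differ only in the high part of the initial condition, which is
    the situation of the second half of Assumption B. *)
Lemma trace_null u v (H : set bits) :
  Pil dot e Nstar u = Pil dot e Nstar v -> measurable H ->
  P (bit_code (trace_events u) @^-1` H) = 0%E ->
  P (bit_code (trace_events v) @^-1` H) = 0%E.
Proof.
move=> uv.
have hu := @Xh_Pih _ _ _ _ Nstar basis_e u.
have hv := @Xh_Pih _ _ _ _ Nstar basis_e v.
have ru := version_Qinf (Xl_Pil dot e Nstar u) hu; rewrite PilDPih in ru.
(* The low part of u plus the high part of v is v itself. *)
have rv := version_Qinf (Xl_Pil dot e Nstar u) hv.
rewrite (_ : Pil dot e Nstar u + Pih dot e Nstar v = v) in rv; last by rewrite uv PilDPih.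
have eq_uv := Qinf_equiv (Xl_Pil dot e Nstar u) hu hv.
apply: (mixed_code_null (@eta_events_measurable R sigma Nstar `[0, +oo[)
  noise_events_generated measurable_low_path_events _ _ ru rv eq_uv).
- exact: measurable_trace_events.
- exact: measurable_trace_events.
Qed.

(** W1 and W2 may fail to be measurable, so the selection is made in the complements of measurable
    null sets covering their exceptions. *)
Lemma same_trace_selection u v (W1 W2 : set (Omega R)) :
  Pil dot e Nstar u = Pil dot e Nstar v ->
  (\forall w \ae P, W1 w) -> (\forall w \ae P, W2 w) ->
  exists w w', [/\ W1 w, W2 w',
    (forall t, 0 <= t -> forall k, (Nstar <= k.+1)%N ->
      sigma k * w k t - sigma k * w k 0 = sigma k * w' k t - sigma k * w' k 0) &
    (forall t, 0 <= t ->
      Pil dot e Nstar (phi 0 t w u) = Pil dot e Nstar (phi 0 t w' v))].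
Proof.
move=> uv [N1 [mN1 N10 W1N]] [N2 [mN2 N20 W2N]].
have PT : P setT != 0%E by rewrite probability_setT onee_neq0.
have [||w [w' [w1 w2 /trace_code_eq[E1 E2]]]] := @code_selection _ _ _ _ _ _ _ _ _ P P
  (trace_events u) (trace_events v) (~` N1) (~` N2)
  (path_closed_regular P) (path_tight P) (path_closed_regular P) (path_tight P)
  (measurable_trace_events u) (measurable_trace_events v)
  (measurableC mN1) (measurableC mN2) _ _ PT (fun H => @trace_null u v H uv).
- by rewrite setCK.
- by rewrite setCK.
exists w, w'; split => //.
- by apply: contrapT => nW; apply: w1; exact: W1N.
- by apply: contrapT => nW; apply: w2; exact: W2N.
Qed.

End Coupling.

(** * Uniqueness of the invariant measure *)

Lemma ae_ysection d1 d2 (T1 : measurableType d1) (T2 : measurableType d2)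
    (R : realType) (P : probability T1 R) (S : set (T1 * T2)) (u : T2) :
  measurable S -> P (~` ysection S u) = 0%E -> \forall w \ae P, S (w, u).
Proof.
move=> mS Pu; exists (~` ysection S u); split => //.
  by apply: measurableC; exact: measurable_ysection.
by move=> w nS; rewrite /ysection /= inE.
Qed.

Section NoSingularInvariants.
Context (R : realType) (X : completeNormedModType R).
Variables (dot : {dot X for idfun}) (e : nat -> X) (Nstar : nat).
Variables (DG : set X) (G : X -> X) (sigma : nat -> R).
Variable P : probability (Omega R) R.
Variable phi : R -> R -> wpath R -> X -> X.
Variable Qt : R -> X -> X -> wpath R -> probability (borel X) R.
Variable Qinf : X -> X -> wpath R -> probability (borel_Cpath X) R.
Hypotheses (basis_e : hilbert_basis dot e)
  (flow_phi : stochastic_flow dot e DG G sigma P phi)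
  (version_Qt : is_Qt dot e Nstar sigma P phi Qt)
  (version_Qinf : is_Qinf dot e Nstar sigma P phi Qinf)
  (hypA : assumptionA dot e Nstar DG G sigma P phi)
  (hypB : assumptionB e Nstar P Qt Qinf).

Lemma same_trace_asymptotic (Bset : set (Cpath X)) u v w w' r :
  (forall (u v : wpath R -> R -> X) (Omega0 : set (wpath R * wpath R)),
      (forall w w', Omega0 (w, w') ->
         [/\ solves dot e DG G sigma w 0 (u w) /\ solves dot e DG G sigma w' 0 (v w'),
             Bset (path_of (u w)) /\ Bset (path_of (v w')),
             (forall t, 0 <= t -> forall k, (Nstar <= k.+1)%N ->
                sigma k * w k t - sigma k * w k 0 =
                sigma k * w' k t - sigma k * w' k 0) &
             (forall t, 0 <= t ->
                Pil dot e Nstar (u w t) = Pil dot e Nstar (v w' t))]) ->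
      forall w w', Omega0 (w, w') ->
        `|Pih dot e Nstar (u w t) - Pih dot e Nstar (v w' t)|
          @[t --> +oo] --> (0 : R)) ->
  solves dot e DG G sigma w 0 (fun t => phi 0 t w u) ->
  solves dot e DG G sigma w' 0 (fun t => phi 0 t w' v) ->
  Bset (path_of (fun t => phi 0 t w u)) -> Bset (path_of (fun t => phi 0 t w' v)) ->
  (forall t, 0 <= t -> forall k, (Nstar <= k.+1)%N ->
     sigma k * w k t - sigma k * w k 0 = sigma k * w' k t - sigma k * w' k 0) ->
  (forall t, 0 <= t ->
     Pil dot e Nstar (phi 0 t w u) = Pil dot e Nstar (phi 0 t w' v)) ->
  0 < r ->
  exists N : nat, forall n, (N <= n)%N ->
    `|phi 0 n.+1%:R w u - phi 0 n.+1%:R w' v| < r.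
Proof.
move=> A su sv Bu Bv ew el r0.
have : `|Pih dot e Nstar (phi 0 t w u) - Pih dot e Nstar (phi 0 t w' v)|
    @[t --> +oo] --> (0 : R).
  (* Assumption A is applied to a single pair of noise paths. *)
  by apply: (A (fun w t => phi 0 t w u) (fun w t => phi 0 t w v) [set (w, w')])
    => // x y [-> ->].
move=> /cvgrPdist_lt/(_ _ r0) [M [Mr hM]].
exists (Num.trunc `|M|) => n Nn; have Mn : M < n.+1%:R.
  apply: le_lt_trans (ler_norm _) _; apply: lt_le_trans (truncnS_gt _) _.
  by rewrite ler_nat ltnS.
(* The low parts agree and cancel, so the distance of the high parts is the full distance. *)
have := hM _ Mn; rewrite sub0r normrN normr_id /Pih el ?ler0n//.
by rewrite opprB addrA subrK.
Qed.

Lemma no_singular_invariant_measures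
    (m1 m2 : {finite_measure set (borel X) -> \bar R}) (A : set (borel X)) :
  measurable A -> m1 (~` A) = 0%E -> m2 A = 0%E ->
  (forall t, 0 < t -> invariant_under P (flow_at phi t) m1) ->
  (forall t, 0 < t -> invariant_under P (flow_at phi t) m2) ->
  m1 setT != 0%E -> m2 setT != 0%E -> False.
Proof.
move=> mA m1A m2A i1 i2 m1T m2T; have [hB1 hB2] := hypB.
(* Sampling at times n + 1 keeps every time positive, the range where invariance is given. *)
have [|||||| T1 [T2 [[mT1 mT2] T10 T20 hT]]] := @asymptotic_gap _ _ _ _ P
  (fun n => flow_at phi n.+1%:R) m1 m2 A.
- by move=> n; exact: (measurable_flow_at flow_phi (ler0n _ _)).
- exact: mA.
- exact: m1A.
- exact: m2A.
- by move=> n; exact: i1.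
- by move=> n; exact: i2.
have [mW1 W10] := full_sections mT1 T10.
have [mW2 W20] := full_sections mT2 T20.
have ac (C : set (borel X)) : measurable C -> m1 (Pil dot e Nstar @^-1` C) = 0%E ->
    m2 (Pil dot e Nstar @^-1` C) = 0%E.
  move=> mC /(invariant_low_modes basis_e flow_phi version_Qt hB1 (i1 1 ltr01) m1T mC).
  by move/(invariant_low_modes basis_e flow_phi version_Qt hB1 (i2 1 ltr01) m2T mC).
have [u [v [Wu Wv uv]]] :=
  same_low_modes_selection basis_e ac mW1 mW2 W10 W20 m2T.
have [Bset [hBset hA]] := hypA; have [_ _ good] := flow_phi.
have FF : Filter (almost_everywhere P) := ae_filter_ringOfSetsType P.
(* The two full sets collect what the contradiction uses: the recurring gap, membership in the set
   of Assumption A, and the flow line being a solution. *)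
have [||w [w' [[T1w Bw sw] [T2w Bw' sw'] ew el]]] := @same_trace_selection
  _ _ _ _ Nstar _ _ _ _ _ basis_e flow_phi _ version_Qinf hB2 u v
  [set w | [/\ T1 (w, u), Bset (path_of (fun t => phi 0 t w u)) &
               solves dot e DG G sigma w 0 (fun t => phi 0 t w u)]]
  [set w | [/\ T2 (w, v), Bset (path_of (fun t => phi 0 t w v)) &
               solves dot e DG G sigma w 0 (fun t => phi 0 t w v)]] uv.
- apply: filterS3 (ae_ysection mT1 Wu) (hBset u) good => w T1w Bw /(_ 0 u)[_ sw _].
  by split.
- apply: filterS3 (ae_ysection mT2 Wv) (hBset v) good => w T2w Bw /(_ 0 v)[_ sw _].
  by split.
have [r r0 gap] := hT _ _ T1w T2w.
have [N hN] := same_trace_asymptotic hA sw sw' Bw Bw' ew el r0.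
have [n Nn] := gap N.
by rewrite /flow_at /= leNgt hN.
Qed.

End NoSingularInvariants.

Unset Implicit Arguments.
Set Strict Implicit.
Set Printing Implicit Defensive.

Theorem theorem6 (R : realType) (X : completeNormedModType R)
    (dot : {dot X for idfun}) (e : nat -> X) (Nstar : nat)
    (DG : set X) (G : X -> X) (sigma : nat -> R)
    (P : probability (Omega R) R)
    (phi : R -> R -> wpath R -> X -> X)
    (Qt : R -> X -> X -> wpath R -> probability (borel X) R)
    (Qinf : X -> X -> wpath R -> probability (borel_Cpath X) R)
    (basis_e : hilbert_basis dot e)
    (Nstar_gt0 : (0 < Nstar)%N)
    (wiener_P : is_wiener P)
    (flow_phi : stochastic_flow dot e DG G sigma P phi)
    (version_Qt : is_Qt dot e Nstar sigma P phi Qt)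
    (version_Qinf : is_Qinf dot e Nstar sigma P phi Qinf)
    (hypA : assumptionA dot e Nstar DG G sigma P phi)
    (hypB : assumptionB e Nstar P Qt Qinf)
    (mu nu : probability (borel X) R)
    (inv_mu : invariant_measure P phi mu) (inv_nu : invariant_measure P phi nu) :
  forall A : set (borel X), measurable A -> mu A = nu A.
Proof.
move=> A mA.
have inv (m : probability (borel X) R) t : invariant_measure P phi m -> 0 < t ->
    invariant_under P (flow_at phi t) m.
  move=> im t0 B mB; apply: etrans (esym (im t t0 B mB)).
  apply: eq_integral => w _ /=; congr (m _).
  by apply/seteqP; split=> u; rewrite /xsection /= inE.
have [m1 [m2 [D [mD m1D m2D hmn]]]] := hahn_jordan_finite_measures mu nu.
have inv12 t : 0 < t -> invariant_under P (flow_at phi t) m1 /\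
    invariant_under P (flow_at phi t) m2.
  move=> t0; apply: (invariant_jordan _ mD m1D m2D hmn).
  - exact: (measurable_flow_at flow_phi (ltW t0)).
  - exact: inv.
  - exact: inv.
(* Both mu and nu have mass 1, so the two Jordan parts vanish together or are both nonzero. *)
have mass : m1 setT = m2 setT.
  have : (1 + m2 setT = 1 + m1 setT)%E.
    by rewrite -{1}(probability_setT mu) -(probability_setT nu); exact: hmn.
  have := fin_num_measure m1 _ (@measurableT _ (borel X)).
  have := fin_num_measure m2 _ (@measurableT _ (borel X)).
  by move=> /fineK <- /fineK <-; rewrite -!EFinD => -[/addrI ->].
(* If the parts vanish, the decomposition identity is mu A = nu A; otherwise they are singular
   nonzero invariant measures, which is impossible. *)
have [m1T|m1T] := eqVneq (m1 setT) 0%E.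
  have m0 (m : {finite_measure set (borel X) -> \bar R}) : m setT = 0%E -> m A = 0%E.
    move=> mT; apply/eqP; rewrite eq_le measure_ge0 andbT -mT.
    exact: le_finite_measure.
  by have := hmn A mA; rewrite (m0 m1)// (m0 m2) -?mass// !adde0.
exfalso; apply: (no_singular_invariant_measures basis_e flow_phi version_Qt
  version_Qinf hypA hypB mD m1D m2D _ _ m1T).
- by move=> t t0; have [] := inv12 t t0.
- by move=> t t0; have [] := inv12 t t0.
- by rewrite -mass.
Qed.
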